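(* Let $(f_n)_{n\ge1}$ be a sequence of continuous excursion-type functions such that $f_n(0)=0$ for every $n\ge1$. Assume that $(f_n)$ converges uniformly to a continuous excursion-type function $f$ such that $f(0)=0$. Then, for every $c>0$, the convergence $$\left(\mathbb L_s(f_n)\right)_{s\in[0,c]}\ \overset{(d)}{\underset{n\to\infty}{\longrightarrow}}\ \left(\mathbb L_s(f)\right)_{s\in[0,c]}$$ holds in distribution in the space $\mathbb D([0,c],\mathbb L(\overline{\mathbb D}))$.
   Context: A continuous excursion-type function is a continuous $f:[0,1]\to\mathbb R$ that is nonnegative with $f(1)=0$. A lamination is a closed subset of the closed unit disk $\overline{\mathbb D}$ which is the union of the unit circle $\mathbb S^1$ and a set of chords that do not intersect in the open unit disk; $\mathbb L(\overline{\mathbb D})$ is the set of laminations with the Hausdorff distance. $\mathbb D(E,F)$ denotes the càdlàg functions from $E$ to $F$ with the Skorokhod $J_1$ topology. For a continuous excursion-type function $f$ with $f(0)=0$, set $\mathcal{EG}(f)=\{(s,t)\in\mathbb R^2: s\in(0,1),\ 0\le t<f(s)\}$. For $u=(s,t)\in\mathcal{EG}(f)$ let $g(f,u)=\sup\{s'\le s: f(s')<t\}$ and $d(f,u)=\inf\{s'\ge s: f(s')<t\}$. Let $\mathcal N(f)$ be a Poisson point process on $\mathbb R^2\times\mathbb R_+$ with intensity $\frac{2}{d(f,u)-g(f,u)}\mathbf 1_{u\in\mathcal{EG}(f)}\,du\,dr$, and let $\mathcal N_c(f)$ be the projection on $\mathbb R^2$ of $\mathcal N(f)\cap(\mathbb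 R^2\times[0,c])$. For $0\le c<\infty$, $\mathbb L_c(f)=\mathbb S^1\cup\bigcup_{u\in\mathcal N_c(f)}[e^{-2i\pi g(f,u)},e^{-2i\pi d(f,u)}]$, where $[y,z]$ is the segment joining $y,z\in\mathbb C$. *)

(* Defs.v *)
From HB Require Import structures.
From mathcomp Require Import all_boot all_order all_algebra.
From mathcomp Require Import all_classical all_reals all_analysis.
From mathcomp Require Import measurable_realfun complex.

Set Implicit Arguments.
Unset Strict Implicit.
Unset Printing Implicit Defensive.
Import Order.TTheory GRing.Theory Num.Theory.
Import numFieldTopology.Exports numFieldNormedType.Exports.
Import ComplexField.Normc.

Local Open Scope classical_set_scope.
Local Open Scope ring_scope.
Local Open Scope complex_scope.

Section plane.
Context {R : realType}.
Implicit Types (x y z : R[i]) (A B : set R[i]).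

Definition unit_circle : set R[i] := [set z | normc z = 1].

Definition open_disk : set R[i] := [set z | normc z < 1].

Definition closed_disk : set R[i] := [set z | normc z <= 1].

Definition segment y z : set R[i] :=
  [set (1 - t)%:C * y + t%:C * z | t in `[0, 1]].

(* e^{-2 i pi x} *)
Definition circle_point (x : R) : R[i] :=
  cos (2 * pi * x) -i* sin (2 * pi * x).

(* A chord is a segment between two points of the circle.  Chords are given by
   pairs of endpoints, (y, z) and (z, y) being the same chord: this is why
   distinctness is that of the segments. *)
Definition non_crossing_chords (K : set (R[i] * R[i])) :=
  (forall p, K p -> unit_circle p.1 /\ unit_circle p.2) /\
  (forall p q, K p -> K q -> segment p.1 p.2 <> segment q.1 q.2 ->
     segment p.1 p.2 `&` segment q.1 q.2 `&` open_disk = set0).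

Definition is_lamination A :=
  [/\ closed (A : set R[i]^o), A `<=` closed_disk &
      exists2 K : set (R[i] * R[i]), non_crossing_chords K &
        A = unit_circle `|` \bigcup_(p in K) segment p.1 p.2].

Definition dist_to A x : R := inf [set normc (x - y) | y in A].

Definition hausdorff_dist A B : R :=
  Num.max (sup [set dist_to B x | x in A]) (sup [set dist_to A y | y in B]).

End plane.

Record lamination (R : realType) := Lamination {
  lamination_set :> set R[i] ;
  lamination_prop : is_lamination lamination_set }.

HB.instance Definition _ (R : realType) := gen_eqMixin (lamination R).
HB.instance Definition _ (R : realType) := gen_choiceMixin (lamination R).

Section lamination_metric.
Context {R : realType}.
Implicit Types (L M N : lamination R) (x y z : R[i]).

Let normcE x : (normc x)%:C = `|x|. Proof. by []. Qed.

Let normc_ge0 x : 0 <= normc x.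
Proof. by case: x => a b /=; exact: sqrtr_ge0. Qed.

Let normc_triangle x y : normc (x + y) <= normc x + normc y.
Proof. by have := ler_normD x y; rewrite -!normcE -rmorphD lecR. Qed.

Let normc_distC x y : normc (x - y) = normc (y - x).
Proof. by have := distrC x y; rewrite -!normcE => -[]. Qed.

Let lam_disk L x : lamination_set L x -> normc x <= 1.
Proof. by case: L => A [? AD ?] /= /AD. Qed.

Let lam_one L : lamination_set L 1.
Proof. by case: L => A [? ? [K _ AE]] /=; rewrite AE; left; exact: normc1. Qed.

Let lam_ne L : (L : set R[i]) !=set0. Proof. by exists 1. Qed.

Let dist_lb L x : lbound [set normc (x - y) | y in L] 0.
Proof. by move=> _ [y _ <-]. Qed.

Let dist_to_le L x y : lamination_set L y -> dist_to L x <= normc (x - y).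
Proof.
move=> Ly; apply: ge_inf; last by exists y.
by exists 0; exact: dist_lb.
Qed.

Let dist_to_ge L x e :
  (forall y, lamination_set L y -> e <= normc (x - y)) -> e <= dist_to L x.
Proof.
move=> h; apply: lb_le_inf.
  by have [y Ly] := lam_ne L; exists (normc (x - y)), y.
by move=> _ [y Ly <-]; exact: h.
Qed.

Let dist_to_ge0 L x : 0 <= dist_to L x.
Proof. by apply: dist_to_ge => y _. Qed.

Let dist_to0 L x : lamination_set L x -> dist_to L x = 0.
Proof.
move=> Lx; apply/eqP; rewrite eq_le dist_to_ge0 andbT.
by rewrite (le_trans (dist_to_le x Lx))// subrr normc0.
Qed.

Let dist_to_ub L M : has_ubound [set dist_to M x | x in L].
Proof.
exists 2 => _ [x /lam_disk Lx <-].
rewrite (le_trans (dist_to_le x (lam_one M)))//.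
rewrite (le_trans (normc_triangle _ _))//.
have -> : normc (-1 : R[i]) = 1 by rewrite -[-1]sub0r normc_distC subr0 normc1.
by rewrite -[leRHS]/(1 + 1) lerD2r.
Qed.

Let dist_to_sup L M x : lamination_set L x -> dist_to M x <= sup [set dist_to M x | x in L].
Proof. by move=> Lx; apply: ub_le_sup; [exact: dist_to_ub | exists x]. Qed.

Let half_le L M e : (forall x, lamination_set L x -> dist_to M x <= e) ->
  sup [set dist_to M x | x in L] <= e.
Proof.
move=> h; apply: ge_sup; last by move=> _ [x Lx <-]; exact: h.
by have [x Lx] := lam_ne L; exists (dist_to M x), x.
Qed.

Let half_triangle L M N : sup [set dist_to N x | x in L] <=
  sup [set dist_to M x | x in L] + sup [set dist_to N x | x in M].
Proof.
apply: half_le => x Lx; rewrite -lerBlDr.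
apply: le_trans (dist_to_sup M Lx); apply: dist_to_ge => y My.
rewrite lerBlDr -lerBlDl; apply: le_trans (dist_to_sup N My).
apply: dist_to_ge => z Nz; rewrite lerBlDl.
rewrite (le_trans (dist_to_le x Nz))//.
by rewrite (le_trans _ (normc_triangle _ _))// addrA subrK.
Qed.

Let hd L M := hausdorff_dist L M.

Let hdxx L : hd L L = 0.
Proof.
rewrite /hd /hausdorff_dist maxxx.
apply/eqP; rewrite eq_le half_le/=; last by move=> x /dist_to0 ->.
by have := dist_to_sup L (lam_one L); rewrite dist_to0//; exact: lam_one.
Qed.

Let hd_sym L M : hd L M = hd M L.
Proof. by rewrite /hd /hausdorff_dist maxC. Qed.

Let hd_triangle M L N : hd L N <= hd L M + hd M N.
Proof.
rewrite /hd /hausdorff_dist ge_max; apply/andP; split.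
  by apply: le_trans (half_triangle _ M _) _; apply: lerD; rewrite le_max lexx.
apply: le_trans (half_triangle _ M _) _.
by rewrite addrC; apply: lerD; rewrite le_max lexx orbT.
Qed.

Let hd0_sub L M : hd L M = 0 -> (L : set R[i]) `<=` M.
Proof.
move=> h x Lx.
have dx0 : dist_to M x <= 0.
  by rewrite (le_trans (dist_to_sup M Lx))// -h /hd /hausdorff_dist le_max lexx.
have Mcl : closed (M : set R[i]^o) by case: M {h dx0} => ? [].
apply: Mcl => B /nbhs_ballP[e /= e0 eB].
have Re_e0 : 0 < complex.Re e.
  by move: e0; case: (e) => a b; rewrite ltcE/= => /andP[].
have eE : e = (complex.Re e)%:C.
  by move: e0; case: (e) => a b; rewrite ltcE/= => /andP[/eqP -> _].
have [y My xye] : exists2 y, lamination_set M y & normc (x - y) < complex.Re e.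
  apply: contrapT => far; have := le_lt_trans dx0 Re_e0; apply/negP.
  rewrite -leNgt; apply: dist_to_ge => y My; rewrite leNgt; apply/negP => xye.
  by apply: far; exists y.
exists y; split => //; apply: eB.
by rewrite /ball/= -normcE eE ltcR.
Qed.

Let hd_positivity L M : hd L M = 0 -> L = M.
Proof.
move=> h; have LM := hd0_sub h; rewrite hd_sym in h; have ML := hd0_sub h.
case: L M LM ML {h} => [A pA] [B pB] /= AB BA.
have E : A = B by apply/seteqP.
by subst B; congr Lamination; exact: Prop_irrelevance.
Qed.

HB.instance Definition _ := @isMetric.Build R (lamination R) hd
  hdxx hd_positivity hd_sym hd_triangle.

End lamination_metric.

Notation timeT c := (set_type `[0, c]%classic).

(* On the left of 0 and on the right of c the filters below are trivial, so
   that nothing is required there. *)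
Definition cadlag {R : realType} {E : metricType R} (c : R) (x : timeT c -> E) :=
  forall t : timeT c,
    x @ within [set s | set_val t < set_val s] (nbhs t) --> x t /\
    exists l : E, x @ within [set s | set_val s < set_val t] (nbhs t) --> l.

Record skorokhod (R : realType) (E : metricType R) (c : R) := Skorokhod {
  skorokhod_fun :> timeT c -> E ;
  skorokhod_cadlag : cadlag skorokhod_fun }.

HB.instance Definition _ (R : realType) (E : metricType R) (c : R) :=
  gen_eqMixin (skorokhod E c).
HB.instance Definition _ (R : realType) (E : metricType R) (c : R) :=
  gen_choiceMixin (skorokhod E c).

(* Increasing bijections of [0, c]; these are automatically homeomorphisms. *)
Definition time_change {R : realType} (c : R) (la : timeT c -> timeT c) :=
  bijective la /\ forall s t, (set_val (la s) <= set_val (la t)) =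
                              (set_val s <= set_val t).

Section skorokhod_topology.
Context {R : realType} {E : metricType R} {c : R}.
Implicit Types x y z : skorokhod E c.

(* The ball of radius e for the distance
     inf_la max (sup_t |la t - t|) (sup_t dist (x t) (y (la t))). *)
Definition j1_ball x (e : R) y :=
  exists la : timeT c -> timeT c, exists e' : R,
    [/\ time_change la, e' < e,
        forall t, `|set_val (la t) - set_val t| <= e' &
        forall t, mdist (x t) (y (la t)) <= e'].

Let j1_ball_center x (e : R) : 0 < e -> j1_ball x e x.
Proof.
move=> e0; exists id, 0; split => //; first by split => //; exists id.
- by move=> t; rewrite subrr normr0.
- by move=> t; rewrite mdistxx.
Qed.

Let j1_ball_sym x y (e : R) : j1_ball x e y -> j1_ball y e x.
Proof.
move=> [la [e' [[[mu laK muK] la_mono] e'e d1 d2]]].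
exists mu, e'; split => //.
- split; first by exists la.
  by move=> s t; rewrite -la_mono !muK.
- by move=> t; rewrite distrC -[X in set_val X - _]muK; exact: d1.
- by move=> t; rewrite metric_sym -[X in y X]muK; exact: d2.
Qed.

Let j1_ball_triangle x y z (e1 e2 : R) :
  j1_ball x e1 y -> j1_ball y e2 z -> j1_ball x (e1 + e2) z.
Proof.
move=> [la [a [[la_bij la_mono] ae1 d1 d2]]].
move=> [mu [b [[mu_bij mu_mono] be2 d3 d4]]].
exists (mu \o la), (a + b); split; last 3 first.
- exact: ltrD.
- move=> t /=; rewrite -[X in `|X|](subrKA (set_val (la t))).
  by rewrite (le_trans (ler_normD _ _))// addrC lerD.
- move=> t /=; rewrite (le_trans (metric_triangle _ (y (la t)) _))//.
  exact: lerD.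
split; first exact: bij_comp.
by move=> s t /=; rewrite mu_mono la_mono.
Qed.

Let j1_ent := entourage_ j1_ball.

HB.instance Definition _ :=
  hasNbhs.Build (skorokhod E c) (nbhs_ j1_ent).

HB.instance Definition _ := @Nbhs_isPseudoMetric.Build R (skorokhod E c)
  j1_ent erefl j1_ball j1_ball_center j1_ball_sym j1_ball_triangle erefl.

End skorokhod_topology.

Definition borel_measurable {d} {Om : measurableType d} {S : topologicalType}
    (X : Om -> S) :=
  forall B : set S, <<s [set U : set S | open U] >> B -> measurable (X @^-1` B).

Definition cvg_in_distribution {R : realType} {S : topologicalType}
    {d_ : nat -> measure_display} {Om_ : forall n, measurableType (d_ n)}
    (P_ : forall n, probability (Om_ n) R) (X_ : forall n, Om_ n -> S)
    {d : measure_display} {Om : measurableType d}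
    (P : probability Om R) (X : Om -> S) :=
  forall phi : S -> R, continuous phi -> (exists M, forall x, `|phi x| <= M) ->
    'E_(P_ n)[phi \o X_ n]%E @[n --> \oo] --> 'E_P[phi \o X]%E.

Definition point_count {R : realType} {Om : Type} {T : choiceType}
    (Pi : Om -> set T) (A : set T) (w : Om) : \bar R :=
  counting (Pi w `&` A).

(* A Poisson point process with diffuse intensity mu, as a random countable
   set of points. *)
Record poisson_point_process {R : realType} {d d'}
    {Om : measurableType d} {T : measurableType d'} (P : probability Om R)
    (mu : set T -> \bar R) (Pi : Om -> set T) : Prop := {
  ppp_countable : forall w, countable (Pi w) ;
  ppp_measurable : forall A, measurable A ->
    measurable_fun setT (point_count Pi A : Om -> \bar R) ;
  ppp_poisson : forall A, measurable A -> (mu A < +oo)%E -> forall k : nat,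
    P [set w | point_count Pi A w = k%:R%:E :> \bar R] =
    (expR (- fine (mu A)) * fine (mu A) ^+ k / k`!%:R)%:E ;
  ppp_infinite : forall A, measurable A -> mu A = +oo%E ->
    P [set w | point_count Pi A w = +oo%E :> \bar R] = 1%E ;
  ppp_independent : forall n (A : 'I_n -> set T) (B : 'I_n -> set (\bar R)),
    (forall i, measurable (A i)) -> trivIset setT A ->
    (forall i, measurable (B i)) ->
    P [set w | forall i, B i (point_count Pi (A i) w)] =
    (\prod_(i < n) P [set w | B i (point_count Pi (A i) w)])%E }.

Section excursion.
Context {R : realType}.
Implicit Types (f : R -> R) (u : R * R) (s : R).

(* Only the values of f on [0, 1] are relevant, here and below. *)
Definition continuous_excursion_type f :=
  [/\ {within `[0, 1], continuous f},
      forall s, 0 <= s <= 1 -> 0 <= f s & f 1 = 0].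

Definition EG f : set (R * R) := [set u | 0 < u.1 < 1 /\ 0 <= u.2 < f u.1].

(* Adding 0 (resp. 1) to the set only matters when the set is empty, which for
   u in EG f with f 0 = f 1 = 0 means u.2 = 0: it encodes the supremum
   (resp. infimum) of the empty set in [0, 1]. *)
Definition exc_g f u : R :=
  sup (0 |` [set s | [/\ 0 <= s, s <= u.1 & f s < u.2]]).

Definition exc_d f u : R :=
  inf (1 |` [set s | [/\ u.1 <= s, s <= 1 & f s < u.2]]).

(* Points of R^2 x R_+ are seen in R^2 x R, with no intensity on negative
   last coordinates. *)
Definition intensity_density f (p : R * R * R) : R :=
  2 / (exc_d f p.1 - exc_g f p.1) * \1_(EG f) p.1
    * \1_[set r : R | 0 <= r] p.2.

Definition intensity f (A : set (R * R * R)) : \bar R :=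
  (\int[(lebesgue_measure \x lebesgue_measure) \x lebesgue_measure]_(p in A)
     (intensity_density f p)%:E)%E.

(* L_s(f) for a configuration N of points of R^2 x R_+. *)
Definition lamination_at f (N : set (R * R * R)) s : set R[i] :=
  unit_circle `|`
  \bigcup_(u in fst @` (N `&` [set p | 0 <= p.2 <= s]))
    segment (circle_point (exc_g f u)) (circle_point (exc_d f u)).

(* L_s(f) is a lamination, and a cadlag function of s, only almost surely;
   as a random element of D([0, c], L) it is defined up to a null event. *)
Definition lamination_process {d} {Om : measurableType d}
    (P : probability Om R) f (N : Om -> set (R * R * R)) (c : R)
    (X : Om -> skorokhod (lamination R) c) :=
  borel_measurable X /\
  {ae P, forall w, forall s : timeT c,
     X w s = lamination_at f (N w) (set_val s) :> set R[i]}.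

End excursion.

(* Main.v *)
Require Import Defs.
From HB Require Import structures.
From mathcomp Require Import all_boot all_order all_algebra.
From mathcomp Require Import all_classical all_reals all_analysis.
From mathcomp Require Import measurable_realfun complex ring lra.

Set Implicit Arguments.
Unset Strict Implicit.
Unset Printing Implicit Defensive.
Import Order.TTheory GRing.Theory Num.Theory.
Import numFieldTopology.Exports numFieldNormedType.Exports.
Import ComplexField.Normc.

Local Open Scope classical_set_scope.
Local Open Scope ring_scope.
Local Open Scope complex_scope.

(* Idea. For u in EG f the intervals [g, d] are pairwise nested or disjoint, so that their chords do
   not cross, and only finitely many marked chords with d - g > delta have appeared by time c,
   because the intensity is at most 2 / delta there; the other chords stay close to the circle. This
   makes s |-> L_s a cadlag path of laminations. Divide [0, 1] into m cells and [0, c] into n cells,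
   with n much larger than m. Outside an event of small probability, uniformly in the excursion, no
   time cell contains two long chords; rounding the long chords and their times to the cells then
   moves the path by little in the J1 distance, the times being realigned by a time change inside
   each cell. The rounded path is a function of the finitely many bits telling which cells of marked
   chords are occupied. These bits are independent, and their laws converge because g(f_n, u) and
   d(f_n, u) converge for all u = (s, t) but those whose level t lies in a countable set (dominated
   convergence). Letting the mesh tend to 0 yields both the Borel measurability of the process and
   the convergence in distribution. *)

(** * Chords and laminations *)

(** The obstacle is that chords accumulate: short ones may have infinite intensity, and long ones
    are finitely many without a deterministic bound on their number. No tightness argument is used:
    each process is compared, on its own probability space, with a path taking finitely many values,
    whose law is a finite list of numbers. The map from bits to paths does not depend on the
    excursion, so only the laws of the bits have to converge. Two long chords in one time cell would
    defeat the comparison, because a time change cannot send two distinct times to the same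
    midpoint. A time cell receives a Poisson number of long chords of mean at most 2 m S c / n,
    where S bounds all the excursions; hence some cell receives two with probability at most n (2 m
    S c / n)^2, which is small once n is large compared with m^2. Test functions are continuous but
    not uniformly so; what is uniform in the excursion is a one-sided estimate of expectations,
    applied to phi and to - phi. *)

Section complex_norm.
Context {R : realType}.
Implicit Types (x y z : R[i]).

Lemma normc_nneg x : 0 <= normc x.
Proof. by case: x => a b /=; exact: sqrtr_ge0. Qed.

Lemma normcB x y : normc (x - y) = normc (y - x).
Proof. by rewrite -normcN opprB. Qed.

Lemma normcR (a : R) : normc a%:C = `|a|.
Proof. by rewrite /= expr0n /= addr0 sqrtr_sqr. Qed.

Lemma normc_le_ReIm (a b : R) : normc (a +i* b) <= `|a| + `|b|.
Proof.
have -> : a +i* b = a%:C + 'i%C * b%:C by rewrite [LHS]complexE.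
rewrite (le_trans (le_normcD _ _))// normcM !normcR.
suff -> : normc ('i%C : R[i]) = 1 by rewrite mul1r.
by rewrite /= expr0n expr1n add0r sqrtr1.
Qed.

(** The balls of [R[i]^o] have radii in [R[i]]. A positive radius has zero imaginary part, so
    closedness can be tested with real distances, here and in [normc_closedP]. *)
Lemma closed_normcP (A : set R[i]) :
  (forall x, ~ A x -> exists2 e, 0 < e & forall y, A y -> e <= normc (x - y)) ->
  closed (A : set R[i]^o).
Proof.
move=> far x clx; apply: contrapT => /far[e e0 xA].
have [y [Ay]] := clx _ (nbhsx_ballx (x : R[i]^o) (e%:C) (eq_ind_r is_true e0 (ltcR _ _))).
have := xA y Ay; rewrite leNgt => /negP xy yx; apply: xy.
by move: yx; rewrite /ball/= -ltcR.
Qed.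

Lemma normc_closedP (A : set R[i]) x : closed (A : set R[i]^o) -> ~ A x ->
  exists2 e, 0 < e & forall y, A y -> e <= normc (x - y).
Proof.
move=> clA nAx; apply: contrapT => near; apply: nAx.
apply: clA => B /nbhs_ballP[e /= e0 eB].
have eE : e = (complex.Re e)%:C.
  by move: e0; case: (e) => a b; rewrite ltcE/= => /andP[/eqP -> _].
have Re0 : 0 < complex.Re e by rewrite -ltcR -eE.
apply: contrapT => AB; apply: near; exists (complex.Re e) => // y Ay.
rewrite leNgt; apply/negP => xy; apply: AB; exists y; split => //.
by apply: eB; rewrite /ball/= eE ltcR.
Qed.

End complex_norm.

Section chords.
Context {R : realType}.
Implicit Types (x y z : R[i]) (p q : R * R) (K L : set (R * R)).

Lemma circle_point_circle (a : R) : unit_circle (circle_point a).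
Proof. by rewrite /unit_circle/= sqrrN cos2Dsin2 sqrtr1. Qed.

Lemma cos_lip (a b : R) : `|cos a - cos b| <= `|a - b|.
Proof.
wlog ab : a b / a <= b.
  move=> h; case: (leP a b) => [|/ltW] ?; first exact: h.
  by rewrite distrC (distrC a); exact: h.
have [t _] := @MVT_segment R cos (fun t => - sin t) a b ab
  (fun t _ => is_derive_cos t) (continuous_subspaceT (@continuous_cos R)).
rewrite distrC (distrC a) => ->; rewrite normrM normrN ler_piMl//.
by rewrite ler_norml sin_geN1 sin_le1.
Qed.

Lemma sin_lip (a b : R) : `|sin a - sin b| <= `|a - b|.
Proof.
wlog ab : a b / a <= b.
  move=> h; case: (leP a b) => [|/ltW] ?; first exact: h.
  by rewrite distrC (distrC a); exact: h.
have [t _] := @MVT_segment R sin cos a b ab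
  (fun t _ => is_derive_sin t) (continuous_subspaceT (@continuous_sin R)).
rewrite distrC (distrC a) => ->; rewrite normrM ler_piMl//.
by rewrite ler_norml cos_geN1 cos_le1.
Qed.

(** The constant is 4 pi instead of 2 pi because the modulus is bounded by the sum of the moduli of
    the coordinates. It enters all later error terms. *)
Lemma circle_point_lip (a b : R) :
  normc (circle_point a - circle_point b) <= 4 * pi * `|a - b|.
Proof.
have -> : circle_point a - circle_point b =
    (cos (2 * pi * a) - cos (2 * pi * b)) +i*
    (- (sin (2 * pi * a) - sin (2 * pi * b))).
  by rewrite /circle_point; simpc; congr Complex; ring.
rewrite (le_trans (normc_le_ReIm _ _))// normrN.
have ->: 4 * pi * `|a - b| = `|2 * pi * a - 2 * pi * b| + `|2 * pi * a - 2 * pi * b|.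
  rewrite -mulrBr normrM (ger0_norm (_ : 0 <= 2 * pi)) ?mulr_ge0 ?pi_ge0//; ring.
by apply: lerD; [exact: cos_lip | exact: sin_lip].
Qed.

Definition chord p : set R[i] := segment (circle_point p.1) (circle_point p.2).

Lemma segmentC y z : segment y z = segment z y.
Proof.
suff h (a b : R[i]) : segment a b `<=` segment b a by apply/seteqP; split; exact: h.
move=> x [t]; rewrite /= in_itv/= => /andP[t0 t1] <-; exists (1 - t).
  by rewrite /= in_itv/=; lra.
by rewrite opprB addrCA subrr addr0 addrC.
Qed.

Lemma segment_near y z x : segment y z x -> normc (x - y) <= normc (z - y).
Proof.
move=> [t]; rewrite /= in_itv/= => /andP[t0 t1] <-.
have -> : (1 - t)%:C * y + t%:C * z - y = t%:C * (z - y).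
  by rewrite rmorphB/= rmorph1; ring.
by rewrite normcM normcR ger0_norm// ler_piMl// normc_nneg.
Qed.

Lemma segment_move y z y' z' x (e : R) : normc (y - y') <= e ->
  normc (z - z') <= e -> segment y z x ->
  exists2 x', segment y' z' x' & normc (x - x') <= e.
Proof.
move=> ye ze [t]; rewrite /= in_itv/= => /andP[t0 t1] <-.
exists ((1 - t)%:C * y' + t%:C * z'); first by exists t => //=; rewrite in_itv/= t0.
have -> : (1 - t)%:C * y + t%:C * z - ((1 - t)%:C * y' + t%:C * z') =
    (1 - t)%:C * (y - y') + t%:C * (z - z') by ring.
rewrite (le_trans (le_normcD _ _))// !normcM !normcR !ger0_norm ?subr_ge0//.
have -> : e = (1 - t) * e + t * e by ring.
by apply: lerD; rewrite ler_wpM2l// subr_ge0.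
Qed.

Lemma segment_disk y z x : normc y <= 1 -> normc z <= 1 -> segment y z x ->
  normc x <= 1.
Proof.
move=> y1 z1 [t]; rewrite /= in_itv/= => /andP[t0 t1] <-.
rewrite (le_trans (le_normcD _ _))// !normcM !normcR !ger0_norm ?subr_ge0//.
rewrite [leRHS](_ : 1 = (1 - t) * 1 + t * 1); last by ring.
by apply: lerD; rewrite ler_wpM2l// subr_ge0.
Qed.

Lemma segment_closed y z : closed (segment y z : set R[i]^o).
Proof.
apply: compact_closed; first exact: norm_hausdorff.
apply: (@continuous_compact R R[i]^o (fun t : R => (1 - t)%:C * y + t%:C * z)).
  apply: continuous_subspaceT => t.
  apply/cvgrPdist_lt => /= e e0.
  have eE : e = (complex.Re e)%:C.
    by move: e0; case: (e) => a b; rewrite ltcE/= => /andP[/eqP -> _].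
  have Re0 : 0 < complex.Re e by rewrite -ltcR -eE.
  (* The summand 1 allows the division when y = z. *)
  have zy0 : 0 < normc (z - y) + 1 by rewrite ltr_wpDl// normc_nneg.
  near=> s.
  have -> : (1 - t)%:C * y + t%:C * z - ((1 - s)%:C * y + s%:C * z) =
    (t - s)%:C * (z - y) by rewrite !rmorphB/= !rmorph1; ring.
  suff : normc ((t - s)%:C * (z - y)) < complex.Re e by rewrite -ltcR -eE.
  rewrite normcM normcR.
  have ts : `|t - s| < complex.Re e / (normc (z - y) + 1).
    near: s; exact: (@nbhsx_ballx R R t _ (divr_gt0 Re0 zy0)).
  rewrite ltr_pdivlMr// in ts.
  by apply: le_lt_trans ts; rewrite ler_wpM2l// lerDl.
exact: segment_compact.
Unshelve. all: by end_near. Qed.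

(* The affine function z |-> cos (pi (b - a)) - <z, e((a + b) / 2)>, which
   vanishes on the line through the chord of endpoints a and b. *)
Definition chord_form p z : R :=
  cos (pi * (p.2 - p.1)) - (cos (pi * (p.1 + p.2)) * complex.Re z
                           - sin (pi * (p.1 + p.2)) * complex.Im z).

(** With X and Y the arguments of the two sines, the form is cos (X + Y) - cos (X - Y). Its sign is
    thus read off the position of s relative to the endpoints. *)
Lemma chord_form_circle p (s : R) : chord_form p (circle_point s) =
  - 2 * sin (pi * (s - p.1)) * sin (pi * (p.2 - s)).
Proof.
rewrite /chord_form /circle_point/=.
have -> : cos (pi * (p.1 + p.2)) * cos (2 * pi * s) -
    sin (pi * (p.1 + p.2)) * - sin (2 * pi * s) =
    cos (pi * (s - p.1) - pi * (p.2 - s)).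
  have -> : pi * (s - p.1) - pi * (p.2 - s) = 2 * pi * s - pi * (p.1 + p.2) by ring.
  rewrite cosB; ring.
have -> : pi * (p.2 - p.1) = pi * (s - p.1) + pi * (p.2 - s) by ring.
rewrite cosB cosD; ring.
Qed.

Lemma chord_form_segment p y z (t : R) :
  chord_form p ((1 - t)%:C * y + t%:C * z) =
  (1 - t) * chord_form p y + t * chord_form p z.
Proof.
case: y => a b; case: z => a' b'; rewrite /chord_form; simpc => /=; ring.
Qed.

Lemma segment_diag y x : segment y y x -> x = y.
Proof. by move=> [t _ <-]; rewrite rmorphB rmorph1; ring. Qed.

(** Nested, or with disjoint interiors. The inequalities are weak: chords may share endpoints, and
    rounding may identify some. *)
Definition parallel p q :=
  [\/ p.2 <= q.1, q.2 <= p.1, p.1 <= q.1 /\ q.2 <= p.2 | q.1 <= p.1 /\ p.2 <= q.2].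

Lemma parallelC p q : parallel p q -> parallel q p.
Proof. by case; [constructor 2|constructor 1|constructor 4|constructor 3]. Qed.

Definition in_unit p := [/\ 0 <= p.1, p.1 <= p.2 & p.2 <= 1].

Lemma sin_pi_ge0 (a : R) : 0 <= a <= 1 -> 0 <= sin (pi * a).
Proof.
move=> /andP[a0 a1]; apply: sin_ge0_pi.
by rewrite mulr_ge0 ?pi_ge0//= ler_piMr// pi_ge0.
Qed.

Lemma sin_pi_gt0 (a : R) : 0 < a < 1 -> 0 < sin (pi * a).
Proof.
move=> /andP[a0 a1]; apply: sin_gt0_pi.
by rewrite mulr_gt0 ?pi_gt0//= gtr_pMr// pi_gt0.
Qed.

Lemma circle_point01 : circle_point (0 : R) = circle_point 1.
Proof. by rewrite /circle_point mulr0 mulr1 cos0 sin0 mulr_natl cos2pi sin2pi. Qed.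

(** The form of p is nonpositive on the arc between its endpoints and nonnegative on the
    complementary arc, and the endpoints of a parallel interval lie in the same closed arc. *)
Lemma chord_form_sign p q : in_unit p -> in_unit q -> parallel p q ->
  (forall s, s = q.1 \/ s = q.2 -> chord_form p (circle_point s) <= 0) \/
  (forall s, s = q.1 \/ s = q.2 -> 0 <= chord_form p (circle_point s)).
Proof.
case: p => a b; case: q => u v [/= a0 ab b1] [/= u0 uv v1] pq.
have neg s : a <= s <= b -> chord_form (a, b) (circle_point s) <= 0.
  move=> /andP[sa sb]; rewrite chord_form_circle/= -mulrA mulNr oppr_le0.
  by rewrite !mulr_ge0// sin_pi_ge0//; lra.
have pos s : 0 <= s <= a \/ b <= s <= 1 -> 0 <= chord_form (a, b) (circle_point s).
  case=> /andP[sa sb]; rewrite chord_form_circle/= -mulrA mulNr oppr_ge0.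
  - have -> : s - a = - (a - s) by ring.
    by rewrite [pi * - _]mulrN sinN mulNr mulrN oppr_le0 !mulr_ge0// sin_pi_ge0//; lra.
  - have -> : b - s = - (s - b) by ring.
    by rewrite [pi * - _]mulrN sinN !mulrN oppr_le0 !mulr_ge0// sin_pi_ge0//; lra.
case: pq => /=.
- by move=> h; right => s [] ->; apply: pos; right; lra.
- by move=> h; right => s [] ->; apply: pos; left; lra.
- by move=> [h1 h2]; left => s [] ->; apply: neg; lra.
- by move=> [h1 h2]; right => s [] ->; apply: pos; [left|right]; lra.
Qed.

(** One of the two sines vanishes, so its argument is 0, pi or - pi. In the last two cases s and an
    endpoint are 0 and 1 in some order, which is one and the same point of the circle. *)
Lemma chord_form_eq0 p (s : R) : in_unit p -> 0 <= s <= 1 ->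
  chord_form p (circle_point s) = 0 -> circle_point p.1 <> circle_point p.2 ->
  circle_point s = circle_point p.1 \/ circle_point s = circle_point p.2.
Proof.
case: p => a b [/= a0 ab b1] /andP[s0 s1] + dist.
rewrite chord_form_circle/= => /eqP; rewrite !mulf_eq0 oppr_eq0 pnatr_eq0/=.
have key (x : R) : -1 <= x <= 1 -> sin (pi * x) == 0 -> [\/ x = 0, x = 1 | x = -1].
  move=> /andP[x0 x1] /eqP sx.
  have [->|xn0] := eqVneq x 0; first by constructor 1.
  have [->|xn1] := eqVneq x 1; first by constructor 2.
  have [->|xnN1] := eqVneq x (-1); first by constructor 3.
  exfalso; have [x_gt0|x_le0] := ltP 0 x.
    have := @sin_pi_gt0 x; rewrite sx ltxx => h.
    suff : 0 < x < 1 by move/h.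
    by rewrite x_gt0 lt_neqAle xn1.
  have := @sin_pi_gt0 (- x); rewrite mulrN sinN sx oppr0 ltxx => h.
  suff : 0 < - x < 1 by move/h.
  rewrite oppr_gt0 lt_neqAle xn0 x_le0/= ltrNl lt_neqAle x0 andbT.
  by rewrite eq_sym.
case/orP => /key h.
- have [|h0|h0|h0] := h; first lra.
  + by left; congr circle_point; lra.
  + have [-> ->] : s = 1 /\ a = 0 by lra.
    by left; rewrite circle_point01.
  + have [-> ->] : s = 0 /\ a = 1 by lra.
    by left; rewrite circle_point01.
- have [|h0|h0|h0] := h; first lra.
  + by right; congr circle_point; lra.
  + have [-> ->] : s = 0 /\ b = 1 by lra.
    by right; rewrite circle_point01.
  + have [-> ->] : s = 1 /\ b = 0 by lra.
    by right; rewrite circle_point01.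
Qed.

(** A common point in the open disk is a combination, with positive weights, of the endpoints of q.
    The affine form of p vanishes there and has a constant weak sign at these endpoints, so it
    vanishes at both: they are the endpoints of p, and the chords coincide. *)
Lemma parallel_non_crossing p q : in_unit p -> in_unit q -> parallel p q ->
  chord p <> chord q -> chord p `&` chord q `&` open_disk = set0.
Proof.
move=> ip iq pq neq; rewrite -subset0 => z [[zp zq]]; rewrite /open_disk/= => z1.
have ends s : z <> circle_point s.
  by move=> zE; move: z1; rewrite zE ltNge circle_point_circle lexx.
have dist : circle_point p.1 <> circle_point p.2.
  by move=> e; move: zp; rewrite /chord e => /segment_diag /ends.
have z0 : chord_form p z = 0.
  case: zp => t _ <-; rewrite chord_form_segment !chord_form_circle.
  by rewrite !subrr !mulr0 sin0 !mulr0 mul0r mulr0 addr0.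
have [q1 q2] : 0 <= q.1 <= 1 /\ 0 <= q.2 <= 1 by case: iq; lra.
case: zq (zq) z0 => t; rewrite /= in_itv/= => /andP[t0 t1] zE zq.
rewrite -zE chord_form_segment => z0.
have tn0 : 0 < t.
  rewrite lt_neqAle t0 andbT; apply/eqP => te; apply: (ends q.1).
  by rewrite -zE -te subr0 mul1r mul0r addr0.
have tn1 : 0 < 1 - t.
  rewrite subr_gt0 lt_neqAle t1 andbT; apply/eqP => te; apply: (ends q.2).
  by rewrite -zE te subrr mul1r mul0r add0r.
have [e1 e2] : chord_form p (circle_point q.1) = 0 /\ chord_form p (circle_point q.2) = 0.
  have [h|h] := chord_form_sign ip iq pq;
    have := h _ (or_introl erefl); have := h _ (or_intror erefl); move: z0; nra.
have := chord_form_eq0 ip q1 e1 dist; have := chord_form_eq0 ip q2 e2 dist.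
have deg : circle_point q.1 <> circle_point q.2.
  by move=> e; move: zq; rewrite /chord e => /segment_diag /ends.
case=> e2'; case=> e1'; apply: neq.
- by case: deg; rewrite e1' e2'.
- by rewrite /chord e1' e2' segmentC.
- by rewrite /chord e1' e2'.
- by case: deg; rewrite e1' e2'.
Qed.

End chords.

(** * Laminar families of intervals and their laminations *)

Section laminations.
Context {R : realType}.
Implicit Types (p q : R * R) (K L : set (R * R)).

Definition lamset K : set R[i] := unit_circle `|` \bigcup_(p in K) chord p.

(** The finiteness clause is what makes the union of the chords and the circle closed: infinitely
    many distinct chords can only accumulate on the circle. *)
Definition laminar K := [/\ forall p, K p -> in_unit p,
  forall p q, K p -> K q -> parallel p q &
  forall e : R, 0 < e -> finite_set [set p | K p /\ e < p.2 - p.1]].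

Lemma chord_disk p : chord p `<=` closed_disk.
Proof.
move=> x; rewrite /closed_disk/= => px.
by apply: segment_disk px; rewrite le_eqVlt; apply/orP; left; apply/eqP; exact: circle_point_circle.
Qed.

Lemma lamset_disk K : lamset K `<=` closed_disk.
Proof.
move=> x [|[p _]]; last exact: chord_disk.
by rewrite /unit_circle /closed_disk/= => ->.
Qed.

(** Around a point at distance rho from the circle, inside the disk, the chords with d - g <= rho /
    (8 pi) stay within rho / 2 of the circle by [circle_point_lip], and the other ones form a finite
    union of closed segments. *)
Lemma lamset_closed K : laminar K -> closed (lamset K : set R[i]^o).
Proof.
move=> [K1 K2 K3]; apply: closed_normcP => x nKx.
have dist_ge (y z : R[i]) : normc y - normc z <= normc (y - z).
  by rewrite lerBlDr (le_trans _ (le_normcD _ _))// subrK.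
have [x1|x1|x1] := ltgtP (normc x) 1; last by exfalso; apply: nKx; left.
- pose rho : R := 1 - normc x; have rho0 : 0 < rho by rewrite subr_gt0.
  have pi0 := pi_gt0 R.
  pose del : R := rho / (8 * pi); have del0 : 0 < del by rewrite divr_gt0// mulr_gt0.
  pose F := [set p | K p /\ del < p.2 - p.1].
  have Fcl : closed (\bigcup_(p in F) chord p : set R[i]^o).
    by apply: closed_bigcup => [|p _]; [exact: K3 | exact: segment_closed].
  have [|e1 e10 He1] := normc_closedP Fcl (x := x).
    by move=> [p [Kp _] px]; apply: nKx; right; exists p.
  exists (Num.min e1 (rho / 2)); first by rewrite lt_min e10 divr_gt0.
  move=> y [yc|[p Kp py]].
    rewrite ge_min; apply/orP; right; rewrite normcB.
    apply: le_trans (dist_ge _ _); rewrite (_ : normc y = 1)//.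
    by rewrite -/rho; lra.
  have [big|small] := ltP del (p.2 - p.1).
    by rewrite ge_min He1//; exists p.
  rewrite ge_min; apply/orP; right.
  have y1 : normc (y - circle_point p.1) <= rho / 2.
    apply: le_trans (segment_near py) _.
    apply: le_trans (circle_point_lip _ _) _.
    have [_ ? _] := K1 _ Kp.
    rewrite ger0_norm ?subr_ge0//.
    have -> : rho / 2 = 4 * pi * del.
      by move: pi0; rewrite /del; move: (pi : R) => P P0; field; exact: lt0r_neq0.
    by rewrite ler_wpM2l// mulr_ge0// ltW.
  have c1 : normc (circle_point p.1) = 1 by exact: circle_point_circle.
  have h1 := dist_ge (circle_point p.1) y; have h2 := dist_ge y x.
  rewrite normcB c1 in h1; rewrite normcB in h2.
  move: h1 h2 y1; rewrite /rho; lra.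
- exists (normc x - 1); first by rewrite subr_gt0.
  move=> y /lamset_disk; rewrite /closed_disk/= => y1.
  by apply: le_trans (dist_ge _ _); rewrite lerD2l lerN2.
Qed.

Lemma laminar_lamination K : laminar K -> is_lamination (lamset K).
Proof.
move=> lamK; split; [exact: lamset_closed | exact: lamset_disk |].
have [K1 K2 K3] := lamK.
exists ((fun p => (circle_point p.1, circle_point p.2)) @` K).
  split=> [_ [p _ <-]|_ _ [p Kp <-] [q Kq <-]] /=.
    by split; exact: circle_point_circle.
  by apply: parallel_non_crossing; [exact: K1|exact: K1|exact: K2].
by rewrite bigcup_image.
Qed.

Lemma hausdorff_le (A B : set R[i]) (e : R) : A !=set0 -> B !=set0 ->
  (forall x, A x -> exists2 y, B y & normc (x - y) <= e) ->
  (forall y, B y -> exists2 x, A x & normc (y - x) <= e) ->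
  hausdorff_dist A B <= e.
Proof.
have half (C D : set R[i]) : C !=set0 ->
    (forall x, C x -> exists2 y, D y & normc (x - y) <= e) ->
    sup [set dist_to D x | x in C] <= e.
  move=> [x0 Cx0] h; apply: ge_sup; first by exists (dist_to D x0), x0.
  move=> _ [x Cx <-]; have [y Dy xy] := h x Cx.
  apply: le_trans xy; apply: ge_inf; last by exists y.
  by exists 0 => _ [z _ <-]; exact: normc_nneg.
by move=> A0 B0 AB BA; rewrite /hausdorff_dist ge_max !half.
Qed.

(** A short interval needs no partner: its chord is close to the circle, which belongs to both
    laminations. *)
Definition close_family (e : R) K L := forall p, K p ->
  p.2 - p.1 <= e \/ exists2 q, L q & `|p.1 - q.1| <= e /\ `|p.2 - q.2| <= e.

Lemma lamset_hausdorff (e : R) K L : 0 <= e ->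
  (forall p, K p -> in_unit p) -> (forall p, L p -> in_unit p) ->
  close_family e K L -> close_family e L K ->
  hausdorff_dist (lamset K) (lamset L) <= 4 * pi * e.
Proof.
move=> e0; have pi0 := pi_gt0 R.
have ne K' : lamset K' !=set0 by exists 1; left; exact: normc1.
have half K' L' : (forall p, K' p -> in_unit p) -> close_family e K' L' ->
    forall x, lamset K' x -> exists2 y, lamset L' y & normc (x - y) <= 4 * pi * e.
  move=> uK' cl x [xc|[p Kp xp]].
    by exists x; [left | rewrite subrr normc0 !mulr_ge0// ltW].
  have [small|[q Lq [pq1 pq2]]] := cl p Kp.
    exists (circle_point p.1); first by left; exact: circle_point_circle.
    apply: le_trans (segment_near xp) _; apply: le_trans (circle_point_lip _ _) _.
    have [_ ? _] := uK' _ Kp.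
    by rewrite ger0_norm ?subr_ge0// ler_wpM2l// mulr_ge0// ltW.
  have lip a b : `|a - b| <= e -> normc (circle_point a - circle_point b) <= 4 * pi * e.
    move=> ab; apply: le_trans (circle_point_lip _ _) _.
    by rewrite ler_wpM2l// mulr_ge0// ltW.
  have [y qy xy] := segment_move (lip _ _ pq1) (lip _ _ pq2) xp.
  by exists y => //; right; exists q.
by move=> uK uL KL LK; apply: hausdorff_le => //; exact: half.
Qed.

End laminations.

(** * Paths of laminations *)

Section paths.
Context {R : realType}.
Implicit Types (p q : R * R * R) (K L : set (R * R * R)) (t s : R).

(** An element ((g, d), r) is a chord with its time of appearance r. Finiteness is required over all
    times together, so that it also isolates the times at which long chords appear. *)
Definition marked_laminar K := [/\ forall p, K p -> in_unit p.1,
  forall p q, K p -> K q -> parallel p.1 q.1 &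
  forall e : R, 0 < e -> finite_set [set p | K p /\ e < p.1.2 - p.1.1]].

Lemma marked_laminar_sub K L : L `<=` K -> marked_laminar K -> laminar (fst @` L).
Proof.
move=> LK [K1 K2 K3]; split=> [_ [p /LK Kp <-]|_ _ [p /LK Kp <-] [q /LK Kq <-]|e e0].
- exact: K1.
- exact: K2.
- apply: sub_finite_set (finite_image fst (K3 e e0)).
  by move=> _ [[p /LK Kp <-] pe]; exists p.
Qed.

Definition before K t := fst @` (K `&` [set p | p.2 <= t]).

Definition lamination_before K (HK : marked_laminar K) t : lamination R :=
  Lamination (laminar_lamination (marked_laminar_sub (@subIsetl _ K [set p | p.2 <= t]) HK)).

(** This is the left limit at t of [lamination_before], by [mdist_before]. *)
Definition lamination_strictly_before K (HK : marked_laminar K) t : lamination R :=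
  Lamination (laminar_lamination (marked_laminar_sub (@subIsetl _ K [set p | p.2 < t]) HK)).

Lemma finite_isolated (F : set R) t : finite_set F ->
  exists2 eta, 0 < eta & forall s, F s -> s != t -> eta <= `|t - s|.
Proof.
move=> finF; have finF' : finite_set (F `\ t) by exact: finite_setD.
have /closed_openC oF : closed (F `\ t).
  exact: (accessible_finite_set_closed.1 (hausdorff_accessible (@Rhausdorff R))).
have /nbhs_ballP[eta /= eta0 etaF] : nbhs t (~` (F `\ t)).
  by apply: open_nbhs_nbhs; split => // -[_]; exact.
exists eta => // s Fs st; rewrite leNgt; apply/negP => ts.
by apply: (etaF s ts); split => //; exact/eqP.
Qed.

Lemma mdist_lamination (K L : set (R * R)) (HK : laminar K) (HL : laminar L) (e : R) :
  0 <= e -> close_family e K L -> close_family e L K ->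
  mdist (Lamination (laminar_lamination HK)) (Lamination (laminar_lamination HL))
    <= 4 * pi * e.
Proof.
by have [K1 _ _] := HK; have [L1 _ _] := HL => *; exact: lamset_hausdorff.
Qed.

Lemma close_family_sub (e : R) (K L : set (R * R)) : 0 <= e -> K `<=` L ->
  close_family e K L.
Proof.
by move=> e0 KL p /KL Lp; right; exists p => //; rewrite !subrr !normr0.
Qed.

(** The chords longer than del are finitely many, so for eta small none appears at a time other than
    t within eta of t. The laminations compared then differ by short chords only. *)
Lemma mdist_before K (HK : marked_laminar K) t (e : R) : 0 < e ->
  exists2 eta, 0 < eta & forall s,
    (t < s < t + eta -> mdist (lamination_before HK t) (lamination_before HK s) < e) /\
    (t - eta < s < t -> mdist (lamination_strictly_before HK t) (lamination_before HK s) < e).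
Proof.
move=> e0; have pi0 := pi_gt0 R.
pose del : R := e / (8 * pi); have del0 : 0 < del by rewrite divr_gt0// mulr_gt0.
have dele : 4 * pi * del < e.
  have -> : 4 * pi * del = e / 2.
    by move: pi0; rewrite /del; move: (pi : R) => P P0; field; exact: lt0r_neq0.
  lra.
have [_ _ /(_ _ del0) fin] := HK.
have [eta eta0 Heta] := finite_isolated t (finite_image snd fin).
exists eta => // s; split=> /andP[ts st]; apply: le_lt_trans dele;
  apply: mdist_lamination (ltW del0) _ _.
- apply: close_family_sub (ltW del0) _ => _ [p [Kp /= pt] <-].
  by exists p => //; split => //=; rewrite (le_trans pt)// ltW.
- move=> _ [p [Kp /= ps] <-].
  have [pt|tp] := leP p.2 t.
    by right; exists p.1; [exists p | rewrite !subrr !normr0 ltW].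
  left; rewrite leNgt; apply/negP => big.
  have : eta <= `|t - p.2| by apply: Heta; [exists p | rewrite gt_eqF].
  by rewrite distrC gtr0_norm ?subr_gt0//; lra.
- move=> _ [p [Kp /= ps] <-].
  have [pt|tp] := leP p.2 s.
    by right; exists p.1; [exists p | rewrite !subrr !normr0 ltW].
  left; rewrite leNgt; apply/negP => big.
  have : eta <= `|t - p.2| by apply: Heta; [exists p | rewrite lt_eqF].
  by rewrite gtr0_norm ?subr_gt0//; lra.
- apply: close_family_sub (ltW del0) _ => _ [p [Kp /= pt] <-].
  by exists p => //; split => //=; rewrite (le_lt_trans pt).
Qed.

Lemma near_timeT (c : R) (t : timeT c) (e : R) : 0 < e ->
  \forall s \near t, `|set_val t - set_val s| < e.
Proof.
move=> e0.
have /cvgrPdist_lt := @initial_continuous (timeT c) R set_val t.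
by move=> /(_ _ e0).
Qed.

Lemma lamination_before_cadlag (c : R) K (HK : marked_laminar K) :
  cadlag (fun t : timeT c => lamination_before HK (set_val t)).
Proof.
move=> t; split; last exists (lamination_strictly_before HK (set_val t));
  apply/cvg_ballP => e e0; have [eta eta0 Heta] := mdist_before HK (set_val t) e0.
- near=> s; rewrite ballEmdist/=; apply: (Heta _).1.
  have ts : set_val t < set_val s by near: s; exact: withinT.
  have : `|set_val t - set_val s| < eta.
    by near: s; apply: cvg_within; exact: near_timeT.
  by rewrite ltr_norml ts/=; lra.
- near=> s; rewrite ballEmdist/=; apply: (Heta _).2.
  have ts : set_val s < set_val t by near: s; exact: withinT.
  have : `|set_val t - set_val s| < eta.
    by near: s; apply: cvg_within; exact: near_timeT.
  by rewrite ltr_norml ts/=; lra.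
Unshelve. all: by end_near. Qed.

Definition lam_path (c : R) K (HK : marked_laminar K) : skorokhod (lamination R) c :=
  Skorokhod (lamination_before_cadlag HK).

End paths.

(** * Time changes and discretization *)

Section cellwise_time_change.
Context {R : realType}.
Implicit Types (x y t s : R) (k n : nat).

(* Moebius bijection of [0, 1[ sending a to 1/2, of inverse [moebius (1 - a)]. *)
Definition moebius (a x : R) : R := x * (1 - a) / (x * (1 - a) + a * (1 - x)).

Let den (a x : R) : 0 < a < 1 -> 0 <= x < 1 -> 0 < x * (1 - a) + a * (1 - x).
Proof. by move=> /andP[? ?] /andP[? ?]; nra. Qed.

Lemma moebius_itv (a x : R) : 0 < a < 1 -> 0 <= x < 1 -> 0 <= moebius a x < 1.
Proof.
move=> ha hx; have d0 := den ha hx; rewrite /moebius; apply/andP; split.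
  by apply: divr_ge0; [nra|exact: ltW].
by rewrite ltr_pdivrMr// mul1r; move: ha hx => /andP[? ?] /andP[? ?]; nra.
Qed.

Lemma moebiusK (a x : R) : 0 < a < 1 -> 0 <= x < 1 ->
  moebius (1 - a) (moebius a x) = x.
Proof.
move=> ha hx; have d0 := lt0r_neq0 (den ha hx).
have := den ha hx; rewrite /moebius; move: ha hx => /andP[a0 a1] /andP[x0 x1] dp.
rewrite /moebius; set d := _ + _ in d0 dp *.
have -> : 1 - x * (1 - a) / d = a * (1 - x) / d by rewrite /d; field.
have -> : x * (1 - a) / d * (1 - (1 - a)) + (1 - a) * (a * (1 - x) / d) =
  a * (1 - a) / d by field.
field; rewrite d0/= !lt0r_neq0//; lra.
Qed.

Lemma moebius_le (a x y : R) : 0 < a < 1 -> 0 <= x -> x <= y -> y < 1 ->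
  moebius a x <= moebius a y.
Proof.
move=> ha x0 xy y1; have dx : 0 < x * (1 - a) + a * (1 - x).
  by apply: den => //; rewrite x0 (le_lt_trans xy).
have dy : 0 < y * (1 - a) + a * (1 - y).
  by apply: den => //; rewrite y1 (le_trans x0).
rewrite /moebius ler_pdivrMr// mulrAC ler_pdivlMr// -subr_ge0.
have -> : y * (1 - a) * (x * (1 - a) + a * (1 - x)) -
  x * (1 - a) * (y * (1 - a) + a * (1 - y)) = (1 - a) * a * (y - x) by ring.
by move: ha => /andP[a0 a1]; rewrite !mulr_ge0// ?subr_ge0// ltW.
Qed.

Lemma moebius_mid (a : R) : 0 < a < 1 -> moebius a a = 1 / 2.
Proof.
move=> /andP[a0 a1]; rewrite /moebius.
have -> : a * (1 - a) + a * (1 - a) = 2 * (a * (1 - a)) by ring.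
by field; rewrite !lt0r_neq0// subr_gt0.
Qed.

(** Each cell [k, k + 1[ is mapped onto itself, its point k + a k going to the midpoint. *)
Definition cellwise (a : nat -> R) t : R :=
  (Num.truncn t)%:R + moebius (a (Num.truncn t)) (t - (Num.truncn t)%:R).

Variable a : nat -> R.
Hypothesis a01 : forall k, 0 < a k < 1.

Let a01' k : 0 < 1 - a k < 1. Proof. by have /andP[? ?] := a01 k; lra. Qed.

Let frac t : 0 <= t -> 0 <= t - (Num.truncn t)%:R < 1.
Proof.
by move=> /truncn_itv/andP[? +]; rewrite -natr1 subr_ge0 ltrBlDl => ->; rewrite andbT.
Qed.

Lemma truncn_cellwise t : 0 <= t -> Num.truncn (cellwise a t) = Num.truncn t.
Proof.
move=> t0; apply: truncn_def; have /andP[m0 m1] := moebius_itv (a01 (Num.truncn t)) (frac t0).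
by rewrite /cellwise lerDl m0/= -natr1 ltrD2l.
Qed.

Lemma cellwise_ge0 t : 0 <= t -> 0 <= cellwise a t.
Proof.
move=> t0; have /andP[m0 m1] := moebius_itv (a01 (Num.truncn t)) (frac t0).
by rewrite addr_ge0.
Qed.

Lemma cellwiseK t : 0 <= t -> cellwise (fun k => 1 - a k) (cellwise a t) = t.
Proof.
move=> t0; rewrite {1}/cellwise truncn_cellwise// {1}/cellwise addrAC subrr add0r.
by rewrite moebiusK// ?frac// addrC subrK.
Qed.

Lemma cellwise_le t s : 0 <= t -> t <= s -> cellwise a t <= cellwise a s.
Proof.
move=> t0 ts; have s0 := le_trans t0 ts.
have /andP[m0 m1] := moebius_itv (a01 (Num.truncn t)) (frac t0).
have /andP[m0' m1'] := moebius_itv (a01 (Num.truncn s)) (frac s0).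
have := le_truncn ts; rewrite leq_eqVlt => /orP[/eqP e|lt_ts].
  rewrite /cellwise e lerD2l moebius_le//.
  - by rewrite -e; case/andP: (frac t0).
  - by rewrite lerD2r.
  - by case/andP: (frac s0).
rewrite /cellwise; have : (Num.truncn t).+1%:R <= (Num.truncn s)%:R :> R by rewrite ler_nat.
rewrite -natr1; lra.
Qed.

Lemma cellwise_dist t : 0 <= t -> `|cellwise a t - t| <= 1.
Proof.
move=> t0; have /andP[m0 m1] := moebius_itv (a01 (Num.truncn t)) (frac t0).
have /andP[f0 f1] := frac t0; rewrite /cellwise ler_norml; lra.
Qed.

Lemma cellwise_nat n : cellwise a n%:R = n%:R.
Proof. by rewrite /cellwise natrK subrr /moebius !mul0r addr0. Qed.

Lemma cellwise_mid t : 0 <= t -> a (Num.truncn t) = t - (Num.truncn t)%:R ->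
  cellwise a t = (Num.truncn t)%:R + 1 / 2.
Proof. by move=> t0 at_; rewrite /cellwise -at_ moebius_mid. Qed.

End cellwise_time_change.

Section time_change_of_cellwise.
Context {R : realType}.
Variables (c : R) (n : nat).
Hypotheses (c0 : 0 < c) (n0 : (0 < n)%N).

Let h : R := c / n%:R.
Let h0 : 0 < h. Proof. by rewrite divr_gt0// ltr0n. Qed.

Lemma timeT_ge0 (t : timeT c) : 0 <= set_val t.
Proof. by have := set_mem (valP t); rewrite /= in_itv/= => /andP[]. Qed.

Lemma timeT_le (t : timeT c) : set_val t <= c.
Proof. by have := set_mem (valP t); rewrite /= in_itv/= => /andP[]. Qed.

Let hn : c / h = n%:R.
Proof. by rewrite /h; field; rewrite !lt0r_neq0// ltr0n. Qed.

(** The integers are fixed points of [cellwise], so 0 and c = h n are fixed after scaling. *)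
Lemma scaled_cellwise_mem (a : nat -> R) (t : timeT c) : (forall k, 0 < a k < 1) ->
  h * cellwise a (set_val t / h) \in `[0, c]%classic.
Proof.
move=> a01; have t0 := timeT_ge0 t; rewrite inE/= in_itv/=.
have th0 : 0 <= set_val t / h by rewrite divr_ge0// ltW.
apply/andP; split; first by rewrite mulr_ge0 ?cellwise_ge0// ltW.
rewrite [leLHS]mulrC -ler_pdivlMr// hn.
by rewrite -(cellwise_nat a) cellwise_le// -hn ler_pM2r ?invr_gt0// timeT_le.
Qed.

Definition scaled_cellwise (a : nat -> R) (a01 : forall k, 0 < a k < 1)
  (t : timeT c) : timeT c := exist (fun x => x \in `[0, c]%classic) _ (scaled_cellwise_mem t a01).

Lemma scaled_cellwise_time_change a (a01 : forall k, 0 < a k < 1) :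
  time_change (scaled_cellwise a01).
Proof.
have b01 k : 0 < 1 - a k < 1 by have /andP[? ?] := a01 k; lra.
have th0 (t : timeT c) : 0 <= set_val t / h by rewrite divr_ge0 ?timeT_ge0// ltW.
have hK x : h * x / h = x by rewrite mulrAC divff ?mul1r// gt_eqF.
have hK' x : h * (x / h) = x by rewrite mulrCA divff ?mulr1// gt_eqF.
have sE a' (a01' : forall k, 0 < a' k < 1) t' :
    set_val (scaled_cellwise a01' t') = h * cellwise a' (set_val t' / h) by [].
have K t : scaled_cellwise b01 (scaled_cellwise a01 t) = t.
  by apply: val_inj; rewrite -[LHS]/(set_val _) !sE hK (cellwiseK a01 (th0 t)) hK'.
have K' t : scaled_cellwise a01 (scaled_cellwise b01 t) = t.
  apply: val_inj; rewrite -[LHS]/(set_val _) !sE hK.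
  rewrite -[X in cellwise X _](_ : (fun k => 1 - (fun k => 1 - a k) k) = a).
    by rewrite (cellwiseK b01 (th0 t)) hK'.
  by apply/funext => k; rewrite opprB addrC subrK.
split; first by exists (scaled_cellwise b01).
move=> s t.
have mono a' (a01' : forall k, 0 < a' k < 1) s' t' : set_val s' <= set_val t' ->
    set_val (scaled_cellwise a01' s') <= set_val (scaled_cellwise a01' t').
  move=> st; rewrite !sE ler_pM2l//; apply: (cellwise_le a01' (th0 _)).
  by rewrite ler_pM2r ?invr_gt0.
apply/idP/idP; last exact: mono.
by move/(mono _ b01); rewrite !K.
Qed.

End time_change_of_cellwise.

(** * Rounding of marked chords to a grid *)

Section discretization.
Context {R : realType}.
Variables (c : R) (m n : nat).
Hypotheses (c0 : 0 < c) (m0 : (0 < m)%N) (n0 : (0 < n)%N).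
Implicit Types (p q : R * R * R) (K L : set (R * R * R)) (t s : R).

Definition cell p : nat * nat * nat :=
  (Num.truncn (m%:R * p.1.1), Num.truncn (m%:R * p.1.2),
   Num.truncn (p.2 / (c / n%:R))).

(** Endpoints are rounded down, but times go to the midpoint of the cell: an interior time can be
    sent there by a time change that preserves the cell. *)
Definition cell_point (x : nat * nat * nat) : R * R * R :=
  (x.1.1%:R / m%:R, x.1.2%:R / m%:R, (x.2%:R + 1 / 2) * (c / n%:R)).

(* A mark in a cell that is not long has d - g <= 2 / m, by [short_cell]. *)
Definition long (x : nat * nat * nat) := (x.1.1.+1 < x.1.2)%N.

Definition discretize K := cell_point @` (cell @` K `&` [set` long]).

(** This is what the realignment of times requires: grid times are fixed by the cellwise time
    changes, so no mark may sit there, and only one time per cell can be sent to the midpoint. *)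
Definition well_spread K := [/\ forall p, K p -> 0 <= p.2 <= c,
  forall p k, K p -> p.2 <> k%:R * (c / n%:R) &
  forall p q, K p -> K q -> long (cell p) -> long (cell q) ->
    (cell p).2 = (cell q).2 -> p = q].

Let m_gt0 : 0 < m%:R :> R. Proof. by rewrite ltr0n. Qed.
Let h := c / n%:R.
Let h_gt0 : 0 < h. Proof. by rewrite divr_gt0// ltr0n. Qed.

Let cell1 p : in_unit p.1 -> (cell p).1.1%:R <= m%:R * p.1.1 < (cell p).1.1.+1%:R.
Proof. by case=> ? ? ?; apply: truncn_itv; rewrite mulr_ge0. Qed.

Let cell2 p : in_unit p.1 -> (cell p).1.2%:R <= m%:R * p.1.2 < (cell p).1.2.+1%:R.
Proof. by case=> ? ? ?; apply: truncn_itv; rewrite mulr_ge0// (le_trans _ (_ : p.1.1 <= _)). Qed.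

(** A whole space cell separates the endpoints of a long mark; the endpoints of any other mark lie
    in the same cell or in adjacent ones. *)
Lemma long_cell p : in_unit p.1 -> long (cell p) -> m%:R^-1 < p.1.2 - p.1.1.
Proof.
move=> up lp; have /andP[_ c1] := cell1 up; have /andP[c2 _] := cell2 up.
rewrite -[ltLHS]mul1r ltr_pdivrMr// mulrC mulrBr.
have : (cell p).1.1.+2%:R <= (cell p).1.2%:R :> R by rewrite ler_nat.
by move: c1; rewrite -!natr1; lra.
Qed.

Lemma short_cell p : in_unit p.1 -> ~~ long (cell p) -> p.1.2 - p.1.1 <= 2 / m%:R.
Proof.
move=> up lp; have /andP[c1 _] := cell1 up; have /andP[_ c2] := cell2 up.
rewrite ler_pdivlMr// mulrC mulrBr.
have : (cell p).1.2%:R <= (cell p).1.1.+1%:R :> R by rewrite ler_nat leqNgt.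
by move: c2; rewrite -!natr1; lra.
Qed.

Lemma cell_point_unit p : in_unit p.1 -> in_unit (cell_point (cell p)).1.
Proof.
move=> up; have [p0 p01 p1] := up; split => /=.
- by rewrite divr_ge0.
- by rewrite ler_pM2r ?invr_gt0// ler_nat le_truncn// ler_pM2l.
- rewrite ler_pdivrMr// mul1r; have /andP[/le_trans-> //] := cell2 up.
  by rewrite ler_piMr.
Qed.

(** [parallel] only involves weak inequalities between endpoints, which the nondecreasing rounding
    preserves. *)
Lemma cell_point_parallel p q : parallel p.1 q.1 ->
  parallel (cell_point (cell p)).1 (cell_point (cell q)).1.
Proof.
have mono (a b : R) : a <= b -> (Num.truncn (m%:R * a))%:R / m%:R <=
    (Num.truncn (m%:R * b))%:R / m%:R :> R.
  by move=> ab; rewrite ler_pM2r ?invr_gt0// ler_nat le_truncn// ler_pM2l.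
case=> [h1|h1|[h1 h2]|[h1 h2]]; [constructor 1|constructor 2|constructor 3|constructor 4].
- exact: mono.
- exact: mono.
- by split; exact: mono.
- by split; exact: mono.
Qed.

Lemma discretize_marked_laminar K : marked_laminar K -> marked_laminar (discretize K).
Proof.
move=> [K1 K2 K3]; split.
- by move=> _ [_ [[p Kp <-] _] <-]; exact/cell_point_unit/K1.
- move=> _ _ [_ [[p Kp <-] _] <-] [_ [[q Kq <-] _] <-].
  exact/cell_point_parallel/K2.
- move=> e e0.
  have fin : finite_set (discretize K).
    apply: finite_image; apply: (@sub_finite_set _ _
      (cell @` [set p | K p /\ m%:R^-1 < p.1.2 - p.1.1])).
      by move=> _ [[p Kp <-] lp]; exists p => //; split => //; apply: long_cell => //; exact: K1.
    by apply: finite_image; apply: K3; rewrite invr_gt0.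
  by apply: sub_finite_set fin => p [].
Qed.

Lemma truncn_dist (x : R) : 0 <= x -> `|x - (Num.truncn (m%:R * x))%:R / m%:R| <= 2 / m%:R.
Proof.
move=> x0; have /andP[x1 x2] : (Num.truncn (m%:R * x))%:R <= m%:R * x < (Num.truncn (m%:R * x)).+1%:R.
  by apply: truncn_itv; rewrite mulr_ge0.
rewrite -(ler_pM2l m_gt0) -[X in X * `|_|]gtr0_norm// -normrM mulrBr.
rewrite !(mulrC m%:R (_ / m%:R)) !divfK ?gt_eqF//.
by move: x2; rewrite ler_norml -natr1; lra.
Qed.

Section spread.
Variables (K : set (R * R * R)) (HK : marked_laminar K) (Kspread : well_spread K).

(** Relative position, in time cell k, of the long mark of this cell. In the absence of such a mark
    the default value gives 1/2, for which [moebius] is the identity. *)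
Let offset k : R :=
  (xget (0, 0, (k%:R + 1 / 2) * h)
     [set p | [/\ K p, long (cell p) & (cell p).2 = k]]).2 / h - k%:R.

Let mark_ge0 p : K p -> 0 <= p.2 / h.
Proof. by move=> Kp; have [/(_ _ Kp)/andP[? _] _ _] := Kspread; rewrite divr_ge0// ltW. Qed.

Let offset01 k : 0 < offset k < 1.
Proof.
rewrite /offset; case: xgetP => [p _ [Kp lp <-]|_]/=; last first.
  by rewrite mulfK ?gt_eqF//; lra.
have := truncn_itv (mark_ge0 Kp); rewrite -natr1 /= -/h => /andP[p1 p2].
rewrite subr_gt0 ltrBlDl p2 andbT lt_neqAle p1 andbT.
(* Equality would put the mark at a grid time. *)
apply/eqP => e; have [_ /(_ _ (cell p).2 Kp) + _] := Kspread; apply.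
by rewrite -/h [RHS]mulrC -[LHS](@divfK _ h) ?gt_eqF// mulrC -e.
Qed.

Let offsetE p : K p -> long (cell p) -> offset (cell p).2 = p.2 / h - (cell p).2%:R.
Proof.
move=> Kp lp; rewrite /offset; case: xgetP => [q _ [Kq lq qp]|/(_ p)]/=.
  by have [_ _ /(_ _ _ Kq Kp lq lp qp) ->] := Kspread.
by case.
Qed.

Let la := scaled_cellwise c0 n0 offset01.

(** [la] is increasing and sends the time of a long mark to the midpoint of its cell, which is the
    time of the rounded mark. *)
Let la_mark p (t : timeT c) : K p -> long (cell p) ->
  ((cell_point (cell p)).2 <= set_val (la t)) = (p.2 <= set_val t).
Proof.
move=> Kp lp; rewrite /= -/h.
have -> : set_val (la t) = h * cellwise offset (set_val t / h) by [].
have <- : cellwise offset (p.2 / h) = (Num.truncn (p.2 / h))%:R + 1 / 2.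
  by apply: cellwise_mid (mark_ge0 Kp) _ => //; exact: offsetE.
rewrite mulrC ler_pM2l// -[RHS](@ler_pM2r _ h^-1) ?invr_gt0//.
have t0 : 0 <= set_val t / h by rewrite divr_ge0 ?timeT_ge0// ltW.
have offset01' k : 0 < 1 - offset k < 1 by have /andP[? ?] := offset01 k; lra.
apply/idP/idP => [|pt]; last by apply: cellwise_le => //; exact: mark_ge0.
move=> /(cellwise_le offset01'); rewrite !cellwiseK//; last exact: mark_ge0.
by apply; rewrite cellwise_ge0//; exact: mark_ge0.
Qed.

(** By [la_mark], the laminations at t and [la t] have the same long chords, up to a rounding of the
    endpoints by at most 2 / m; the remaining chords have d - g <= 2 / m. With the constant 4 pi of
    [lamset_hausdorff] this gives 8 pi / m. As [la] preserves the time cells, it moves times by at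
    most h. *)
Lemma path_discretize (e : R) : h < e -> 8 * pi / m%:R < e ->
  j1_ball (lam_path c HK) e (lam_path c (discretize_marked_laminar HK)).
Proof.
move=> he me; have [K1 _ _] := HK.
exists la, (Num.max h (8 * pi / m%:R)); split.
- exact: scaled_cellwise_time_change.
- by rewrite gt_max he.
- move=> t; rewrite le_max; apply/orP; left.
  have -> : set_val (la t) = h * cellwise offset (set_val t / h) by [].
  have t0 : 0 <= set_val t / h by rewrite divr_ge0 ?timeT_ge0// ltW.
  have -> : h * cellwise offset (set_val t / h) - set_val t =
      h * (cellwise offset (set_val t / h) - set_val t / h).
    by rewrite mulrBr (mulrCA h) divff ?mulr1// gt_eqF.
  by rewrite normrM gtr0_norm// ler_piMr ?(ltW h_gt0)// cellwise_dist.
- move=> t; rewrite le_max; apply/orP; right.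
  have -> : 8 * pi / m%:R = 4 * pi * (2 / m%:R) :> R.
    by move: (pi : R) => P; field; rewrite gt_eqF.
  have e0 : 0 <= 2 / m%:R :> R by rewrite divr_ge0.
  apply: mdist_lamination => // p.
    move=> [q [Kq /= qt] <-]; have uq := K1 _ Kq; have [q0 q01 _] := uq.
    have [lq|sq] := boolP (long (cell q)); last by left; exact: short_cell.
    right; exists (cell_point (cell q)).1.
      exists (cell_point (cell q)) => //; split; last by rewrite /= la_mark.
      by exists (cell q) => //; split => //; exists q.
    by split; apply: truncn_dist => //; exact: le_trans q01.
  move=> [_ [[_ [[q Kq <-] lq] <-]]] /=; rewrite la_mark// => qt <-.
  have uq := K1 _ Kq; have [q0 q01 _] := uq.
  right; exists q.1; first by exists q.
  by split; rewrite distrC; apply: truncn_dist => //; exact: le_trans q01.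
Qed.

End spread.

End discretization.

(** * Excursion intervals *)

Section excursion_intervals.
Context {R : realType}.
Implicit Types (f : R -> R) (u v : R * R) (s t x : R).

Lemma excursion_cont f x e : continuous_excursion_type f -> 0 <= x <= 1 -> 0 < e ->
  exists2 eta, 0 < eta & forall y, 0 <= y <= 1 -> `|x - y| < eta -> `|f x - f y| < e.
Proof.
move=> [/subspace_continuousP cf _ _] x01 e0; have := cf x; rewrite /= in_itv/= => /(_ x01).
move=> /cvgrPdist_lt /(_ _ e0) /nbhs_ballP[eta /= eta0 H].
by exists eta => // y y01 xy; apply: H => //=; rewrite in_itv.
Qed.

Lemma exc_g_ge0 f u : 0 <= exc_g f u.
Proof.
rewrite /exc_g; have [h|h] := pselect (has_ubound (0 |` [set s | [/\ 0 <= s, s <= u.1 & f s < u.2]])).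
  by apply: ub_le_sup => //; left.
by rewrite sup_out// => -[].
Qed.

Lemma exc_d_le1 f u : exc_d f u <= 1.
Proof.
rewrite /exc_d; have [h|h] := pselect (has_lbound (1 |` [set s | [/\ u.1 <= s, s <= 1 & f s < u.2]])).
  by apply: ge_inf => //; left.
by rewrite inf_out// => -[].
Qed.

Lemma exc_g_ub f u : 0 <= u.1 -> ubound (0 |` [set s | [/\ 0 <= s, s <= u.1 & f s < u.2]]) u.1.
Proof. by move=> u0 y [->|[]]. Qed.

Lemma exc_d_lb f u : u.1 <= 1 -> lbound (1 |` [set s | [/\ u.1 <= s, s <= 1 & f s < u.2]]) u.1.
Proof. by move=> u0 y [->|[]]. Qed.

Lemma exc_g_upper f u s : 0 <= u.1 -> 0 <= s <= u.1 -> f s < u.2 -> s <= exc_g f u.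
Proof.
move=> u0 /andP[s0 su] fs; apply: ub_le_sup; last by right.
by exists u.1; exact: exc_g_ub.
Qed.

Lemma exc_d_lower f u s : u.1 <= 1 -> u.1 <= s <= 1 -> f s < u.2 -> exc_d f u <= s.
Proof.
move=> u0 /andP[s0 su] fs; apply: ge_inf; last by right.
by exists u.1; exact: exc_d_lb.
Qed.

Lemma exc_g_le f u x : 0 <= x ->
  (forall s, 0 <= s <= u.1 -> f s < u.2 -> s <= x) -> exc_g f u <= x.
Proof.
move=> x0 h; apply: ge_sup; first by exists 0; left.
by move=> y [->|[s0 su]] //; apply: h; rewrite s0.
Qed.

Lemma exc_d_ge f u x : x <= 1 ->
  (forall s, u.1 <= s <= 1 -> f s < u.2 -> x <= s) -> x <= exc_d f u.
Proof.
move=> x0 h; apply: lb_le_inf; first by exists 1; left.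
by move=> y [->|[s0 su]] //; apply: h; rewrite s0.
Qed.

Lemma exc_g_adherent f u x : 0 <= x < exc_g f u ->
  exists s, [/\ 0 <= s <= u.1, x < s & f s < u.2].
Proof.
move=> /andP[x0 xg]; apply: contrapT => H; move: xg; rewrite ltNge => /negP; apply.
apply: exc_g_le => // s su fs; rewrite leNgt; apply/negP => xs.
by apply: H; exists s.
Qed.

Lemma exc_d_adherent f u x : exc_d f u < x <= 1 ->
  exists s, [/\ u.1 <= s <= 1, s < x & f s < u.2].
Proof.
move=> /andP[xg x0]; apply: contrapT => H; move: xg; rewrite ltNge => /negP; apply.
apply: exc_d_ge => // s su fs; rewrite leNgt; apply/negP => xs.
by apply: H; exists s.
Qed.

Lemma exc_interval_ge f u x : 0 <= u.1 <= 1 -> exc_g f u < x < exc_d f u -> u.2 <= f x.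
Proof.
move=> /andP[u0 u1] /andP[gx xd]; rewrite leNgt; apply/negP => fx.
have x0 := exc_g_ge0 f u; have x1 := exc_d_le1 f u.
have [xu|ux] := leP x u.1.
  by have := @exc_g_upper f u x u0; rewrite xu fx; lra.
by have := @exc_d_lower f u x u1; rewrite (ltW ux) fx; lra.
Qed.

Variables (f : R -> R) (hf : continuous_excursion_type f) (f0 : f 0 = 0).

(** By continuity f stays above u.2 near u.1; [exc_d_gt] is symmetric. *)
Lemma exc_g_lt u : EG f u -> exc_g f u < u.1.
Proof.
move=> [/andP[u0 u1] /andP[t0 tf]].
have [||eta eta0 H] := @excursion_cont f u.1 (f u.1 - u.2) hf.
  by rewrite !ltW.
  by rewrite subr_gt0.
have x_lt : Num.max 0 (u.1 - eta) < u.1 by rewrite gt_max u0/=; lra.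
apply: le_lt_trans x_lt; apply: exc_g_le; first by rewrite le_max lexx.
move=> s /andP[s0 su] fs; rewrite le_max; apply/orP; right.
rewrite leNgt; apply/negP => us.
have := H s; rewrite s0/= (le_trans su (ltW u1)) => /(_ isT).
by rewrite ger0_norm ?subr_ge0// => /(_ ltac:(lra)); rewrite ltr_norml; lra.
Qed.

Lemma exc_d_gt u : EG f u -> u.1 < exc_d f u.
Proof.
move=> [/andP[u0 u1] /andP[t0 tf]].
have [||eta eta0 H] := @excursion_cont f u.1 (f u.1 - u.2) hf.
  by rewrite !ltW.
  by rewrite subr_gt0.
have x_lt : u.1 < Num.min 1 (u.1 + eta) by rewrite lt_min u1/=; lra.
apply: lt_le_trans x_lt _; apply: exc_d_ge; first by rewrite ge_min lexx.
move=> s /andP[s0 su] fs; rewrite ge_min; apply/orP; right.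
rewrite leNgt; apply/negP => us.
have := H s; rewrite su/= (le_trans (ltW u0) s0) => /(_ isT).
by rewrite ler0_norm ?subr_le0// => /(_ ltac:(lra)); rewrite ltr_norml; lra.
Qed.

Lemma exc_in_unit u : EG f u -> in_unit (exc_g f u, exc_d f u).
Proof.
move=> Eu; split => /=; [exact: exc_g_ge0| |exact: exc_d_le1].
by rewrite ltW// (lt_trans (exc_g_lt Eu)) ?exc_d_gt.
Qed.

(** Let u have the lower level. A point where f is below the level of u is also below that of v, so
    it cannot lie inside the interval of v. If the two intervals overlap, that of v is therefore
    contained in that of u. *)
Lemma exc_parallel u v : EG f u -> EG f v ->
  parallel (exc_g f u, exc_d f u) (exc_g f v, exc_d f v).
Proof.
wlog uv : u v / u.2 <= v.2.
  move=> h Eu Ev; have [|/ltW] := leP u.2 v.2; first by move=> ?; exact: h.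
  by move=> ?; apply: parallelC; exact: h.
move=> Eu Ev; have gu := exc_g_lt Eu; have du := exc_d_gt Eu.
have gv := exc_g_lt Ev; have dv := exc_d_gt Ev.
have [u0 u1] : 0 <= u.1 /\ u.1 <= 1 by case: Eu => /andP[? ?] _; split; rewrite ltW.
have [v0 v1] : 0 <= v.1 /\ v.1 <= 1 by case: Ev => /andP[? ?] _; split; rewrite ltW.
have [h1|h1] := leP (exc_d f u) (exc_g f v); first by constructor 1.
have [h2|h2] := leP (exc_d f v) (exc_g f u); first by constructor 2.
constructor 3 => /=; split.
  apply: exc_g_le; first exact: exc_g_ge0.
  move=> s su fs; rewrite leNgt; apply/negP => gs.
  have sg := exc_g_upper u0 su fs.
  have := @exc_interval_ge f v s; rewrite v0 v1 gs (le_lt_trans sg h2) => /(_ isT isT).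
  by move/(le_trans uv); rewrite leNgt fs.
apply: exc_d_ge; first exact: exc_d_le1.
move=> s su fs; rewrite leNgt; apply/negP => gs.
have sg := exc_d_lower u1 su fs.
have := @exc_interval_ge f v s; rewrite v0 v1 gs (lt_le_trans h1 sg) => /(_ isT isT).
by move/(le_trans uv); rewrite leNgt fs.
Qed.

(** Points where f < u.2 exist arbitrarily close to g on its left, or g = 0 and then f 0 = 0 <= u.2;
    just to the right of g one has f >= u.2. Continuity concludes. *)
Lemma exc_g_level u : EG f u -> f (exc_g f u) = u.2.
Proof.
move=> Eu; have gu := exc_g_lt Eu; have du := exc_d_gt Eu; have g0 := exc_g_ge0 f u.
have [/andP[u0 u1] /andP[t0 tf]] := Eu.
have g01 : 0 <= exc_g f u <= 1 by rewrite g0 ltW// (lt_trans gu).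
apply/eqP; rewrite eq_le; apply/andP; split.
  rewrite leNgt; apply/negP => ft.
  have [|eta eta0 H] := @excursion_cont f _ (f (exc_g f u) - u.2) hf g01.
    by rewrite subr_gt0.
  have gn0 : exc_g f u != 0.
    by apply/eqP => e; move: ft; rewrite e f0 ltNge t0.
  have [s [/andP[s0 su] sx fs]] : exists s, [/\ 0 <= s <= u.1, Num.max 0 (exc_g f u - eta) < s & f s < u.2].
    apply: exc_g_adherent; rewrite le_max lexx/= gt_max; apply/andP; split.
      by rewrite lt_neqAle eq_sym gn0.
    by rewrite ltrBlDr ltrDl.
  have sg : s <= exc_g f u by apply: exc_g_upper => //; rewrite ?s0// ltW.
  have := H s; rewrite s0 (le_trans su (ltW u1)) ger0_norm ?subr_ge0// => /(_ isT).
  by move: sx; rewrite gt_max => /andP[_ sx] /(_ ltac:(lra)); rewrite ltr_norml; lra.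
rewrite leNgt; apply/negP => ft.
have [|eta eta0 H] := @excursion_cont f _ (u.2 - f (exc_g f u)) hf g01.
  by rewrite subr_gt0.
pose y := Num.min u.1 (exc_g f u + eta / 2).
have gy : exc_g f u < y by rewrite lt_min gu/=; lra.
have yu : y <= u.1 by rewrite ge_min lexx.
have ye : y <= exc_g f u + eta / 2 by rewrite ge_min lexx orbT.
have := @exc_interval_ge f u y; rewrite (ltW u0) (ltW u1) gy (le_lt_trans yu du) => /(_ isT isT) fy.
have := H y; rewrite (le_trans g0 (ltW gy)) (le_trans yu (ltW u1)) => /(_ isT).
by rewrite ltr0_norm ?subr_lt0// => /(_ ltac:(lra)); rewrite ltr_norml; lra.
Qed.

Lemma exc_d_level u : EG f u -> f (exc_d f u) = u.2.
Proof.
move=> Eu; have gu := exc_g_lt Eu; have du := exc_d_gt Eu; have g0 := exc_d_le1 f u.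
have [/andP[u0 u1] /andP[t0 tf]] := Eu; have [_ _ f1] := hf.
have g01 : 0 <= exc_d f u <= 1 by rewrite g0 andbT ltW// (lt_trans u0).
apply/eqP; rewrite eq_le; apply/andP; split.
  rewrite leNgt; apply/negP => ft.
  have [|eta eta0 H] := @excursion_cont f _ (f (exc_d f u) - u.2) hf g01.
    by rewrite subr_gt0.
  have gn0 : exc_d f u != 1.
    by apply/eqP => e; move: ft; rewrite e f1 ltNge t0.
  have [s [/andP[s0 su] sx fs]] : exists s, [/\ u.1 <= s <= 1, s < Num.min 1 (exc_d f u + eta) & f s < u.2].
    apply: exc_d_adherent; rewrite ge_min lexx/= andbT lt_min; apply/andP; split.
      by rewrite lt_neqAle gn0.
    by rewrite ltrDl.
  have sg : exc_d f u <= s by apply: exc_d_lower => //; rewrite ?s0// ltW.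
  have := H s; rewrite su (le_trans (ltW u0) s0) ler0_norm ?subr_le0// => /(_ isT).
  by move: sx; rewrite lt_min => /andP[_ sx] /(_ ltac:(lra)); rewrite ltr_norml; lra.
rewrite leNgt; apply/negP => ft.
have [|eta eta0 H] := @excursion_cont f _ (u.2 - f (exc_d f u)) hf g01.
  by rewrite subr_gt0.
pose y := Num.max u.1 (exc_d f u - eta / 2).
have gy : y < exc_d f u by rewrite gt_max du/=; lra.
have yu : u.1 <= y by rewrite le_max lexx.
have ye : exc_d f u - eta / 2 <= y by rewrite le_max lexx orbT.
have := @exc_interval_ge f u y; rewrite (ltW u0) (ltW u1) gy (lt_le_trans gu yu) => /(_ isT isT) fy.
have := H y; rewrite (le_trans (ltW gy) g0) (le_trans (ltW u0) yu) => /(_ isT).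
by rewrite gtr0_norm ?subr_gt0// => /(_ ltac:(lra)); rewrite ltr_norml; lra.
Qed.

(* The levels at which f may have a local minimum. *)
Definition min_levels : set R :=
  range (fun pq : rat * rat => inf (f @` `[ratr pq.1, ratr pq.2]%classic)).

Lemma countable_min_levels : countable min_levels.
Proof. exact: (card_le_trans (card_image_le _ _) (countableP _)). Qed.

(** If f x = u.2 at an interior point, then u.2 is the minimum of f on a rational interval
    containing x and contained in ]g, d[. *)
Lemma exc_interval_gt u x : EG f u -> ~ min_levels u.2 ->
  exc_g f u < x < exc_d f u -> u.2 < f x.
Proof.
move=> Eu nm xgd; have [/andP[u0 u1] _] := Eu.
have uge y : exc_g f u < y < exc_d f u -> u.2 <= f y.
  by apply: exc_interval_ge; rewrite !ltW.
rewrite lt_neqAle uge// andbT; apply/eqP => fx; apply: nm.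
have /andP[gx xd] := xgd.
have [p] := rat_in_itvoo gx; rewrite in_itv/= => /andP[gp px].
have [q] := rat_in_itvoo xd; rewrite in_itv/= => /andP[xq qd].
exists (p, q) => //=; apply/eqP; rewrite eq_le; apply/andP; split.
  apply: ge_inf; last by exists x => //=; rewrite in_itv/= !ltW.
  exists u.2 => _ [y + <-]; rewrite /= in_itv/= => /andP[py yq]; apply: uge.
  by rewrite (lt_le_trans gp)//= (le_lt_trans yq).
apply: lb_le_inf; first by exists (f x), x => //=; rewrite in_itv/= !ltW.
move=> _ [y + <-]; rewrite /= in_itv/= => /andP[py yq]; apply: uge.
by rewrite (lt_le_trans gp)//= (le_lt_trans yq).
Qed.

End excursion_intervals.

Section measurable_sets.
Context d (T : measurableType d) (R : realType).
Variables (D : set T) (g h : T -> R).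
Hypotheses (mD : measurable D) (mg : measurable_fun D g) (mh : measurable_fun D h).

Lemma measurable_set_lt : measurable (D `&` [set x | g x < h x]).
Proof. by have /(_ [set true]) := measurable_fun_ltr mg mh mD; exact. Qed.

Lemma measurable_set_le : measurable (D `&` [set x | g x <= h x]).
Proof. by have /(_ [set true]) := measurable_fun_ler mg mh mD; exact. Qed.

End measurable_sets.

(** * Measurability of the endpoints of excursion intervals *)

Section excursion_measurability.
Context {R : realType}.
Variables (f : R -> R) (hf : continuous_excursion_type f).
Implicit Types (u : R * R).

Let I01 : set R := `[0, 1]%classic.

Let mf : measurable_fun I01 f.
Proof.
case: hf => cf _ _; apply: subspace_continuous_measurable_fun => //.
exact: measurable_itv.
Qed.

Let mI01 : measurable I01. Proof. exact: measurable_itv. Qed.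

Let mf1 : measurable_fun (I01 `*` setT) (fun u : R * R => f u.1).
Proof.
apply: (measurable_comp (F := I01)) => //.
- by move=> _ [u [u01 _] <-].
- exact: measurable_funTS measurable_fst.
Qed.

Let mD : measurable (I01 `*` setT : set (R * R)).
Proof. exact: measurableX. Qed.

Lemma measurable_EG : measurable (EG f).
Proof.
have -> : EG f = (`]0, 1[%classic `*` `[0, +oo[%classic) `&`
    ((I01 `*` setT) `&` [set u | u.2 < f u.1]).
  apply/seteqP; split => [[s t] [/= s01 /andP[t0 tf]]|[s t]/=].
    rewrite !in_itv/= t0 s01; split => //; split => //; split => //.
    by rewrite /I01/= in_itv/=; case/andP: s01 => ? ?; rewrite !ltW.
  by rewrite !in_itv/= andbT => -[[s01 t0] [_ tf]]; split; rewrite ?t0.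
apply: measurableI; first exact: measurableX.
by apply: measurable_set_lt => //; exact: measurable_funTS measurable_snd.
Qed.

Lemma measurable_graph :
  measurable ((I01 `*` setT) `&` [set u : R * R | u.2 = f u.1]).
Proof.
rewrite (_ : _ `&` _ =
  ((I01 `*` setT) `&` [set u | f u.1 <= u.2]) `&`
  ((I01 `*` setT) `&` [set u | u.2 <= f u.1])).
  by apply: measurableI; apply: measurable_set_le => //;
    exact: measurable_funTS measurable_snd.
apply/seteqP; split => u /=; first by move=> [h ->]; rewrite lexx.
by move=> [[h1 h2] [_ h3]]; split => //; apply/eqP; rewrite eq_le h3.
Qed.

Let mEG := measurable_EG.

(** For x >= 0, g > x holds iff f q < u.2 for some rational q with x < q <= u.1: rationals suffice
    by continuity. This is a countable union of rectangles. [measurable_exc_d] is symmetric. *)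
Lemma measurable_exc_g : measurable_fun (EG f) (exc_g f).
Proof.
move=> _; apply: (measurability _ (RGenOInfty.measurableE R)) => // _ [_ [x ->] <-].
have [x0|x0] := leP 0 x; last first.
  rewrite (_ : _ `&` _ = EG f)//; apply/seteqP; split => [u []//|u Eu]; split => //=.
  by rewrite in_itv/= andbT (lt_le_trans x0)// exc_g_ge0.
pose B (q : rat) : set (R * R) := if (x < ratr q :> R) && (ratr q <= 1 :> R) then
  `[ratr q, +oo[%classic `*` `]f (ratr q), +oo[%classic else set0.
have -> : EG f `&` exc_g f @^-1` `]x, +oo[ = EG f `&` \bigcup_q B q.
  apply/seteqP; split => u [Eu]; rewrite /= ?in_itv/= ?andbT => h; split => //.
    have [/andP[u0 u1] _] := Eu; rewrite ?andbT in h.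
    have [s [/andP[s0 su] xs fs]] : exists s, [/\ 0 <= s <= u.1, x < s & f s < u.2].
      by apply: exc_g_adherent; rewrite x0.
    have [|| eta eta0 H] := @excursion_cont _ f s (u.2 - f s) hf; rewrite ?subr_gt0//.
      by rewrite s0 (le_trans su) ?ltW.
    have : Num.max x (s - eta) < s by rewrite gt_max xs ltrBlDr ltrDl.
    move=> /rat_in_itvoo[q]; rewrite in_itv/= gt_max => /andP[/andP[xq sq] qs].
    exists q => //; have qu := le_trans (ltW qs) su.
    rewrite /B xq (le_trans qu (ltW u1)); split; rewrite /= in_itv/= andbT//.
    have := H (ratr q); rewrite (le_trans x0 (ltW xq)) (le_trans qu (ltW u1)) => /(_ isT).
    by rewrite gtr0_norm ?subr_gt0// => /(_ ltac:(lra)); rewrite ltr_norml; lra.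
  case: h => q _; rewrite /B; case: ifPn => // /andP[xq q1]/= []; rewrite !in_itv/= !andbT.
  move=> qu fq; have [/andP[u0 u1] _] := Eu; apply: (lt_le_trans xq).
  by apply: exc_g_upper; rewrite ?(ltW u0)// (le_trans x0 (ltW xq)).
apply: measurableI => //; apply: bigcupT_measurable_rat => // q.
by rewrite /B; case: ifPn => // _; apply: measurableX.
Qed.

Lemma measurable_exc_d : measurable_fun (EG f) (exc_d f).
Proof.
move=> _; apply: (measurability _ (RGenInftyO.measurableE R)) => // _ [_ [x ->] <-].
have [x0|x0] := leP x 1; last first.
  rewrite (_ : _ `&` _ = EG f)//; apply/seteqP; split => [u []//|u Eu]; split => //=.
  by rewrite in_itv/= (le_lt_trans _ x0)// exc_d_le1.
pose B (q : rat) : set (R * R) := if (ratr q < x :> R) && (0 <= ratr q :> R) then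
  `]-oo, ratr q]%classic `*` `]f (ratr q), +oo[%classic else set0.
have -> : EG f `&` exc_d f @^-1` `]-oo, x[ = EG f `&` \bigcup_q B q.
  apply/seteqP; split => u [Eu]; rewrite /= ?in_itv/= ?andbT => h; split => //.
    have [/andP[u0 u1] _] := Eu; rewrite ?andbT in h.
    have [s [/andP[s0 su] xs fs]] : exists s, [/\ u.1 <= s <= 1, s < x & f s < u.2].
      by apply: exc_d_adherent; rewrite h.
    have [|| eta eta0 H] := @excursion_cont _ f s (u.2 - f s) hf; rewrite ?subr_gt0//.
      by rewrite su (le_trans _ s0) ?ltW.
    have : s < Num.min x (s + eta) by rewrite lt_min xs ltrDl.
    move=> /rat_in_itvoo[q]; rewrite in_itv/= lt_min => /andP[sq /andP[xq qs]].
    exists q => //; have qu := le_trans s0 (ltW sq).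
    rewrite /B xq (le_trans (ltW u0) qu); split; rewrite /= in_itv/= ?andbT//.
    have := H (ratr q); rewrite (le_trans (ltW u0) qu) (le_trans (ltW xq) x0) => /(_ isT).
    by rewrite ltr0_norm ?subr_lt0// => /(_ ltac:(lra)); rewrite ltr_norml; lra.
  case: h => q _; rewrite /B; case: ifPn => // /andP[xq q1]/= []; rewrite !in_itv/= ?andbT.
  move=> qu fq; have [/andP[u0 u1] _] := Eu; apply: (le_lt_trans _ xq).
  by apply: exc_d_lower; rewrite ?(ltW u1)// qu (le_trans (ltW xq) x0).
apply: measurableI => //; apply: bigcupT_measurable_rat => // q.
by rewrite /B; case: ifPn => // _; apply: measurableX.
Qed.

End excursion_measurability.

(** * Intensities *)

Section regions.
Context {R : realType}.
Variables (c : R) (m n : nat).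
Hypotheses (c0 : 0 < c) (m0 : (0 < m)%N) (n0 : (0 < n)%N).
Implicit Types (f : R -> R) (u : R * R) (p : R * R * R) (x : nat * nat * nat).

Definition exc_mark f p : R * R * R := (exc_g f p.1, exc_d f p.1, p.2).

Definition region f x : set (R * R * R) :=
  [set p | [/\ EG f p.1, 0 <= p.2 & cell c m n (exc_mark f p) = x]].

Let m_gt0 : 0 < m%:R :> R. Proof. by rewrite ltr0n. Qed.

Let h_gt0 : 0 < c / n%:R. Proof. by rewrite divr_gt0// ltr0n. Qed.

Lemma measurable_region f x : continuous_excursion_type f -> measurable (region f x).
Proof.
case: x => [[i j] k] hf.
have mI0 : measurable (`[0, +oo[%classic : set R) by exact: measurable_itv.
pose D : set (R * R * R) := EG f `*` `[0, +oo[%classic.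
have mD : measurable D by apply: measurableX => //; exact: measurable_EG.
have mcomp (g : R * R -> R) : measurable_fun (EG f) g ->
    measurable_fun D (fun p => g p.1).
  move=> mg; apply: (measurable_comp (F := EG f)) => //.
  - exact: measurable_EG.
  - by move=> _ [p [Ep _] <-].
  - exact: measurable_funTS measurable_fst.
have mg := mcomp _ (measurable_exc_g hf); have md := mcomp _ (measurable_exc_d hf).
have mr : measurable_fun D (fun p => p.2) by exact: measurable_funTS measurable_snd.
have mitv (g : R * R * R -> R) (k' : nat) : measurable_fun D g ->
    measurable (D `&` ([set p | k'%:R <= g p] `&` [set p | g p < k'.+1%:R])).
  move=> mg'; rewrite setIIr; apply: measurableI.
    exact: measurable_set_le.
  exact: measurable_set_lt.
have -> : region f (i, j, k) =
    (D `&` ([set p | i%:R <= m%:R * exc_g f p.1] `&` [set p | m%:R * exc_g f p.1 < i.+1%:R])) `&`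
    (D `&` ([set p | j%:R <= m%:R * exc_d f p.1] `&` [set p | m%:R * exc_d f p.1 < j.+1%:R])) `&`
    (D `&` ([set p | k%:R <= p.2 / (c / n%:R)] `&` [set p | p.2 / (c / n%:R) < k.+1%:R])).
  have tE (a : R) (l : nat) : 0 <= a -> Num.truncn a = l <-> l%:R <= a /\ a < l.+1%:R.
    by move=> a0; rewrite (rwP eqP) truncn_eq// (rwP andP).
  have pos p : EG f p.1 -> 0 <= p.2 -> [/\ 0 <= m%:R * exc_g f p.1,
      0 <= m%:R * exc_d f p.1 & 0 <= p.2 / (c / n%:R)].
    move=> Ep p0; have [g0 gd d1] := exc_in_unit hf Ep; split.
    - by rewrite mulr_ge0.
    - by rewrite mulr_ge0// (le_trans g0).
    - by rewrite divr_ge0// ltW.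
  apply/seteqP; split => p /=.
    move=> [Ep p0 []]; have [h1 h2 h3] := pos p Ep p0.
    by move=> /tE-/(_ h1) ? /tE-/(_ h2) ? /tE-/(_ h3) ?; rewrite /D/= in_itv/= p0.
  rewrite /D/= in_itv/= andbT => -[[[[Ep p0] hi] [_ hj]] [_ hk]].
  have [h1 h2 h3] := pos p Ep p0; split => //.
  by congr (_, _, _); apply/tE.
apply: measurableI; first apply: measurableI; apply: mitv => //.
- by apply: measurable_funM => //; exact: measurable_cst.
- by apply: measurable_funM => //; exact: measurable_cst.
- by apply: measurable_funM => //; exact: measurable_cst.
Qed.

Lemma density_EG f p : EG f p.1 -> 0 <= p.2 ->
  intensity_density f p = 2 / (exc_d f p.1 - exc_g f p.1).
Proof. by move=> Ep p0; rewrite /intensity_density !indicE !mem_set//= !mulr1. Qed.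

Lemma density_region f x p : region f x p ->
  intensity_density f p = 2 / (exc_d f p.1 - exc_g f p.1).
Proof. by move=> [Ep p0 _]; exact: density_EG. Qed.

Lemma density_ge0 f p : continuous_excursion_type f -> 0 <= intensity_density f p.
Proof.
move=> hf; rewrite /intensity_density indicE.
have [|_] := boolP (p.1 \in EG f); last by rewrite mulr0 mul0r.
rewrite inE => Ep; have [_ /= gd _] := exc_in_unit hf Ep.
by rewrite mulr1 mulr_ge0// divr_ge0// subr_ge0.
Qed.

Lemma density_long f x p : continuous_excursion_type f -> region f x p -> long x ->
  intensity_density f p <= 2 * m%:R.
Proof.
move=> hf rp lx; rewrite (density_region rp); case: rp => Ep p0 cx.
have := @long_cell R c m n m0 (exc_mark f p) (exc_in_unit hf Ep).
rewrite cx /= => /(_ lx) gd.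
rewrite ler_pM2l// -[leRHS]invrK lef_pV2 ?posrE ?invr_gt0//; first exact: ltW.
by rewrite (lt_trans _ gd)// invr_gt0.
Qed.

(** The density vanishes outside this set, and the measurability of the endpoints is established on
    [EG f]. *)
Definition timed_EG f : set (R * R * R) := EG f `*` `[0, +oo[%classic.

Lemma measurable_timed_EG f : continuous_excursion_type f -> measurable (timed_EG f).
Proof.
by move=> hf; apply: measurableX; [exact: measurable_EG|exact: measurable_itv].
Qed.

Lemma measurable_density f : continuous_excursion_type f ->
  measurable_fun (timed_EG f) (intensity_density f).
Proof.
move=> hf; have mD := measurable_timed_EG hf.
(* The inverse is written as a power of exponent -1, which is measurable on the whole line. *)
apply: (eq_measurable_fun (fun p => 2 * powR (exc_d f p.1 - exc_g f p.1) (-1))).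
  move=> p; rewrite inE => -[Ep]; rewrite /= in_itv/= andbT => p0.
  rewrite density_EG// powR_inv1//.
  by have [_ /= gd _] := exc_in_unit hf Ep; rewrite subr_ge0.
apply: measurable_funM; first exact: measurable_cst.
apply: (measurableT_comp (f := @powR R ^~ (-1))
  (g := fun p => exc_d f p.1 - exc_g f p.1)); first exact: measurable_powR.
have mcomp (g : R * R -> R) : measurable_fun (EG f) g ->
    measurable_fun (timed_EG f) (fun p => g p.1).
  move=> mg; apply: (measurable_comp (F := EG f)) => //.
  - exact: measurable_EG.
  - by move=> _ [p [Ep _] <-].
  - exact: measurable_funTS measurable_fst.
by apply: measurable_funB; apply: mcomp; [exact: measurable_exc_d|exact: measurable_exc_g].
Qed.

Lemma region_timed_EG f x : region f x `<=` timed_EG f.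
Proof. by move=> p [Ep p0 _]; split; rewrite //= in_itv/= p0. Qed.

End regions.

(** * Stability of excursion intervals under uniform convergence *)

Section convergence_of_intervals.
Context {R : realType}.
Variables (f_ : nat -> R -> R) (f : R -> R).
Hypotheses (hf_ : forall n, continuous_excursion_type (f_ n))
  (hf : continuous_excursion_type f) (f0 : f 0 = 0).
Hypothesis f_f : forall e, 0 < e ->
  \forall n \near \oo, forall s, 0 <= s <= 1 -> `|f s - f_ n s| < e.
Implicit Types (u : R * R) (p : R * R * R).

Lemma near_ltl s t : 0 <= s <= 1 -> f s < t -> \forall n \near \oo, f_ n s < t.
Proof.
move=> s01 fst; have := f_f (_ : 0 < t - f s); rewrite subr_gt0 => /(_ fst).
by apply: filterS => k /(_ s s01); rewrite ltr_norml; lra.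
Qed.

Lemma near_gtl s t : 0 <= s <= 1 -> t < f s -> \forall n \near \oo, t < f_ n s.
Proof.
move=> s01 fst; have := f_f (_ : 0 < f s - t); rewrite subr_gt0 => /(_ fst).
by apply: filterS => k /(_ s s01); rewrite ltr_norml; lra.
Qed.

(** f attains its minimum on the compact interval, which leaves a uniform margin above t. *)
Lemma near_gt_itv a b t : 0 <= a -> a <= b -> b <= 1 ->
  (forall s, a <= s <= b -> t < f s) ->
  \forall n \near \oo, forall s, a <= s <= b -> t < f_ n s.
Proof.
move=> a0 ab b1 tf.
have cf : {within `[a, b], continuous f}.
  case: hf => + _ _; apply: continuous_subspaceW => s.
  by rewrite /= !in_itv/= => /andP[? ?]; rewrite (le_trans a0)// (le_trans _ b1).
have [s sab smin] := EVT_min ab cf; rewrite in_itv/= in sab.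
have := f_f (_ : 0 < f s - t); rewrite subr_gt0 => /(_ (tf s sab)).
apply: filterS => k H y yab; have := H y; case/andP: (yab) => ay yb.
rewrite (le_trans a0 ay) (le_trans yb b1) => /(_ isT).
by have := smin y; rewrite in_itv/= yab => /(_ isT); rewrite ltr_norml; lra.
Qed.

Lemma near_EG u : EG f u -> \forall n \near \oo, EG (f_ n) u.
Proof.
move=> [/andP[u0 u1] /andP[t0 tf]]; near=> k; split; first by rewrite u0.
by rewrite t0/=; near: k; apply: near_gtl; rewrite // !ltW.
Unshelve. all: by end_near. Qed.

Lemma near_notEG u : ~ EG f u -> u.2 != f u.1 -> \forall n \near \oo, ~ EG (f_ n) u.
Proof.
move=> nE tf; have [u01|nu] := boolP ((0 < u.1 < 1) && (0 <= u.2)); last first.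
  by near=> k => -[u01 /andP[t0 _]]; rewrite u01 t0 in nu.
case/andP: u01 => u01 t0; have ft : f u.1 < u.2.
  rewrite lt_neqAle eq_sym tf leNgt; apply/negP => tf'.
  by apply: nE; split; rewrite ?t0.
near=> k => -[_ /andP[_]]; apply/negP; rewrite -leNgt ltW//.
by near: k; apply: near_ltl => //; case/andP: u01 => ? ?; rewrite !ltW.
Unshelve. all: by end_near. Qed.

(** Above: on [y, u.1] with g < y, f exceeds u.2 strictly because u.2 is not a minimum level, hence
    so does f_n eventually, and g_n <= y. Below: a point slightly to the left of g where f < u.2
    remains such a point for f_n. *)
Lemma exc_g_cvg u : EG f u -> ~ min_levels f u.2 ->
  exc_g (f_ n) u @[n --> \oo] --> exc_g f u.
Proof.
move=> Eu nm; have gu := exc_g_lt hf Eu; have du := exc_d_gt hf Eu.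
have g0 := exc_g_ge0 f u; have [/andP[u0 u1] _] := Eu.
apply/cvgrPdist_le => /= e e0.
pose y := Num.min u.1 (exc_g f u + e).
have gy : exc_g f u < y by rewrite lt_min gu ltrDl.
have yu : y <= u.1 by rewrite ge_min lexx.
have ye : y <= exc_g f u + e by rewrite ge_min lexx orbT.
have y0 : 0 <= y by rewrite (le_trans g0)// ltW.
have upper : \forall n \near \oo, exc_g (f_ n) u <= y.
  have fgt s : y <= s <= u.1 -> u.2 < f s.
    by move=> /andP[ys su]; apply: exc_interval_gt => //; rewrite (lt_le_trans gy)// (le_lt_trans su).
  have := near_gt_itv y0 yu (ltW u1) fgt; apply: filterS => k H.
  apply: exc_g_le => // s /andP[s0 su] fs; rewrite leNgt; apply/negP => ys.
  by have := H s; rewrite (ltW ys) su => /(_ isT); rewrite ltNge (ltW fs).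
have lower : \forall n \near \oo, exc_g f u - e <= exc_g (f_ n) u.
  have [ge0|ge0] := leP 0 (exc_g f u - e); last first.
    by near=> k; rewrite (le_trans (ltW ge0))// exc_g_ge0.
  have [s [/andP[s0 su] gs fs]] : exists s, [/\ 0 <= s <= u.1, exc_g f u - e < s & f s < u.2].
    by apply: exc_g_adherent; rewrite ge0/= ltrBlDr ltrDl.
  have := @near_ltl s u.2; rewrite s0 (le_trans su (ltW u1)) => /(_ isT fs).
  apply: filterS => k fks; apply: (le_trans (ltW gs)).
  by apply: exc_g_upper; rewrite ?s0// ltW.
by near=> k; rewrite ler_distlC; apply/andP; split;
  [near: k|apply: le_trans ye; near: k].
Unshelve. all: by end_near. Qed.

Lemma exc_d_cvg u : EG f u -> ~ min_levels f u.2 ->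
  exc_d (f_ n) u @[n --> \oo] --> exc_d f u.
Proof.
move=> Eu nm; have gu := exc_g_lt hf Eu; have du := exc_d_gt hf Eu.
have d1 := exc_d_le1 f u; have [/andP[u0 u1] _] := Eu.
apply/cvgrPdist_le => /= e e0.
pose y := Num.max u.1 (exc_d f u - e).
have yd : y < exc_d f u by rewrite gt_max du ltrBlDr ltrDl.
have uy : u.1 <= y by rewrite le_max lexx.
have ye : exc_d f u - e <= y by rewrite le_max lexx orbT.
have y1 : y <= 1 by rewrite (le_trans _ d1)// ltW.
have lower : \forall n \near \oo, y <= exc_d (f_ n) u.
  have fgt s : u.1 <= s <= y -> u.2 < f s.
    by move=> /andP[us sy]; apply: exc_interval_gt => //; rewrite (lt_le_trans gu)// (le_lt_trans sy).
  have := near_gt_itv (ltW u0) uy y1 fgt; apply: filterS => k H.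
  apply: exc_d_ge => // s /andP[us s1] fs; rewrite leNgt; apply/negP => sy.
  by have := H s; rewrite (ltW sy) us => /(_ isT); rewrite ltNge (ltW fs).
have upper : \forall n \near \oo, exc_d (f_ n) u <= exc_d f u + e.
  have [de1|de1] := leP (exc_d f u + e) 1; last first.
    by near=> k; rewrite (le_trans (exc_d_le1 _ _))// ltW.
  have [s [/andP[us s1] sd fs]] : exists s, [/\ u.1 <= s <= 1, s < exc_d f u + e & f s < u.2].
    by apply: exc_d_adherent; rewrite de1 ltrDl e0.
  have := @near_ltl s u.2; rewrite (le_trans (ltW u0) us) s1 => /(_ isT fs).
  apply: filterS => k fks; apply: le_trans (ltW sd).
  by apply: exc_d_lower; rewrite ?us// ltW.
by near=> k; rewrite ler_distlC; apply/andP; split;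
  [apply: (le_trans ye); near: k|near: k].
Unshelve. all: by end_near. Qed.

Lemma truncn_cvg (x_ : nat -> R) (x : R) : 0 <= x -> (forall k : nat, x <> k%:R) ->
  x_ n @[n --> \oo] --> x -> \forall n \near \oo, Num.truncn (x_ n) = Num.truncn x.
Proof.
move=> x0 xk x_x; have /andP[kx xk1] := truncn_itv x0.
have kx' : (Num.truncn x)%:R < x by rewrite lt_neqAle kx andbT; apply/eqP => /esym/xk.
near=> k; apply: truncn_def; apply/andP; split.
  by apply: ltW; near: k; exact: (cvgr_gt x).
by near: k; exact: (cvgr_lt x).
Unshelve. all: by end_near. Qed.

Section grid.
Variables (c : R) (m n : nat).
Hypotheses (m0 : (0 < m)%N).

(** The second family consists of the levels at which an endpoint may lie on the grid, where
    rounding is discontinuous: f takes the value u.2 at both endpoints. *)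
Definition bad_levels : set R := min_levels f `|` range (fun i : nat => f (i%:R / m%:R)).

Lemma countable_bad_levels : countable bad_levels.
Proof.
rewrite /bad_levels -bigcup2E; apply: bigcup_countable => // -[|[|k]] _ /=.
- exact: countable_min_levels.
- exact: (card_le_trans (card_image_le _ _) (countableP _)).
- exact: countable0.
Qed.

Lemma near_region x p : EG f p.1 -> ~ bad_levels p.1.2 ->
  \forall k \near \oo, region c m n (f_ k) x p <-> region c m n f x p.
Proof.
move=> Ep nb; have m_gt0 : 0 < m%:R :> R by rewrite ltr0n.
have nm : ~ min_levels f p.1.2 by move=> h; apply: nb; left.
have ng (y : R) : f y = p.1.2 -> forall k : nat, m%:R * y <> k%:R.
  move=> fy k e; apply: nb; right; exists k => //; rewrite -e.
  by rewrite mulrC mulKf// gt_eqF.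
have [g0 gd _] := exc_in_unit hf Ep; have d0 := le_trans g0 gd; rewrite /= in g0 d0.
have tg : \forall k \near \oo, Num.truncn (m%:R * exc_g (f_ k) p.1) =
    Num.truncn (m%:R * exc_g f p.1).
  apply: truncn_cvg; [by rewrite mulr_ge0|exact/ng/exc_g_level|].
  by apply: cvgMr; exact: exc_g_cvg.
have td : \forall k \near \oo, Num.truncn (m%:R * exc_d (f_ k) p.1) =
    Num.truncn (m%:R * exc_d f p.1).
  apply: truncn_cvg; [by rewrite mulr_ge0|exact/ng/exc_d_level|].
  by apply: cvgMr; exact: exc_d_cvg.
near=> k; rewrite /region/= /cell/=.
have -> : Num.truncn (m%:R * exc_g (f_ k) p.1) = Num.truncn (m%:R * exc_g f p.1) by near: k.
have -> : Num.truncn (m%:R * exc_d (f_ k) p.1) = Num.truncn (m%:R * exc_d f p.1) by near: k.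
have Ekp : EG (f_ k) p.1 by near: k; exact: near_EG.
by split => -[].
Unshelve. all: by end_near. Qed.

(** Off the graph of f, membership in [EG (f_ k)] settles. Off the bad levels the endpoints converge
    and their cells settle. Both exceptional sets are null. *)
Lemma density_cvg x p : ~ bad_levels p.1.2 -> p.1.2 != f p.1.1 ->
  (intensity_density (f_ k) \_ (region c m n (f_ k) x)) p @[k --> \oo] -->
  (intensity_density f \_ (region c m n f x)) p.
Proof.
move=> nb nf; have [Ep|nEp] := pselect (EG f p.1); last first.
  rewrite [X in _ --> X](_ : _ = 0); last first.
    by rewrite patchE; case: ifPn => //; rewrite inE => -[].
  apply: cvg_near_cst; near=> k; rewrite patchE ifF//.
  apply/negbTE; rewrite notin_setE => -[Ep _ _].
  by have : ~ EG (f_ k) p.1 by near: k; exact: near_notEG.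
have [rp|nrp] := pselect (region c m n f x p); last first.
  rewrite [X in _ --> X](_ : _ = 0); last by rewrite patchE memNset.
  apply: cvg_near_cst; near=> k; rewrite patchE ifF//.
  apply/negbTE; rewrite notin_setE => rkp; apply: nrp.
  have : region c m n (f_ k) x p <-> region c m n f x p by near: k; exact: near_region.
  by case=> + _; apply.
rewrite patchE mem_set// (density_region rp).
apply: cvg_trans (_ : 2 / (exc_d (f_ k) p.1 - exc_g (f_ k) p.1) @[k --> \oo] --> _).
  apply: near_eq_cvg; near=> k; have rkp : region c m n (f_ k) x p.
    have : region c m n (f_ k) x p <-> region c m n f x p by near: k; exact: near_region.
    by case=> _; apply.
  by rewrite patchE mem_set// (density_region rkp).
have nm : ~ min_levels f p.1.2 by move=> h; apply: nb; left.
apply: cvgMr; apply: cvgV.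
  by rewrite subr_eq0 gt_eqF// (lt_trans (exc_g_lt hf Ep))// (exc_d_gt hf Ep).
by apply: cvgB; [exact: exc_d_cvg|exact: exc_g_cvg].
Unshelve. all: by end_near. Qed.

End grid.

End convergence_of_intervals.

Section intensities.
Context {R : realType}.
Implicit Types (f : R -> R) (u : R * R) (p : R * R * R) (x : nat * nat * nat).

Local Notation leb := (@lebesgue_measure R).
Local Notation leb3 := ((leb \x leb) \x leb)%E.

Lemma intensity_le f (A box : set (R * R * R)) (b : R) :
  continuous_excursion_type f -> measurable A -> measurable box ->
  A `<=` timed_EG f -> A `<=` box -> 0 <= b ->
  (forall p, A p -> intensity_density f p <= b) ->
  (intensity f A <= b%:E * leb3 box)%E.
Proof.
move=> hf mA mbox AD Abox b0 Ab.
have mdA : measurable_fun A (intensity_density f).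
  exact: (measurable_funS (measurable_timed_EG hf) AD (measurable_density hf)).
apply: (@le_trans _ _ (\int[leb3]_(p in A) (cst b%:E) p)%E).
  apply: ge0_le_integral => //.
  - by move=> p _; rewrite lee_fin density_ge0.
  - exact/measurable_EFinP.
by rewrite integral_cst// lee_wpmul2l ?lee_fin// le_measure ?inE.
Qed.

Lemma intensity0 f (A : set (R * R * R)) : continuous_excursion_type f ->
  measurable A -> (forall p, A p -> intensity_density f p = 0) -> intensity f A = 0%E.
Proof. by move=> hf mA A0; apply: integral0_eq => p Ap; rewrite A0. Qed.

(** The integral is first restricted to [timed_EG f], where the density is measurable. *)
Lemma intensity_null f (A : set (R * R * R)) : continuous_excursion_type f ->
  measurable A -> leb3 A = 0%E -> intensity f A = 0%E.
Proof.
move=> hf mA A0; rewrite /intensity.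
have mD := measurable_timed_EG hf; have mAD : measurable (A `&` timed_EG f) by exact: measurableI.
transitivity (\int[leb3]_(p in A `&` timed_EG f) (intensity_density f p)%:E)%E.
  rewrite integral_mkcond [RHS]integral_mkcond; apply: eq_integral => p _.
  rewrite !patchE in_setI; case: (p \in A) => //=; case: ifPn => //.
  rewrite notin_setE => nDp; congr EFin.
  rewrite /intensity_density !indicE; have [Ep|nEp] := boolP (p.1 \in EG f).
    rewrite memNset ?mulr0// => /= p0; apply: nDp; split; first by rewrite inE in Ep.
    by rewrite /= in_itv/= p0.
  by rewrite mulr0 mul0r.
apply: null_set_integral => //.
  apply: (measurable_funS mD); first by move=> ? [].
  by apply/measurable_EFinP; exact: measurable_density.
apply/eqP; rewrite eq_le measure_ge0 andbT -A0 le_measure ?inE//.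
Qed.

Lemma leb3_box (a b : R) (t : R) : 0 <= a -> 0 <= t ->
  leb3 ((`[0, 1] `*` `[0, a]) `*` `[b, b + t])%classic = (a * t)%:E.
Proof.
move=> a0 t0.
have -> : leb3 ((`[0, 1] `*` `[0, a]) `*` `[b, b + t])%classic =
    (leb `[0%R, 1%R]%classic * leb `[0%R, a]%classic * leb `[b, (b + t)%R]%classic)%E.
  rewrite product_measure1E//; last by apply: measurableX; exact: measurable_itv.
  by congr (_ * _)%E; exact: product_measure1E.
have itvE (y z : R) : y <= z -> leb `[y, z]%classic = (z - y)%:E.
  rewrite le_eqVlt => /orP[/eqP ->|yz]; rewrite lebesgue_measure_itv/= lte_fin.
    by rewrite ltxx subrr.
  by rewrite yz EFinB.
rewrite !itvE ?ler01 ?lerDl//; rewrite -!EFinM; congr EFin; ring.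
Qed.

Lemma leb3_time_null (C : set R) : measurable C -> leb C = 0%E ->
  leb3 (setT `*` C) = 0%E.
Proof.
move=> mC C0; rewrite product_measure1E// [X in (_ * X)%E](_ : _ = 0%E) ?mule0//.
Qed.

Lemma leb3_level_null (C : set R) : measurable C -> leb C = 0%E ->
  leb3 ((setT `*` C) `*` setT) = 0%E.
Proof.
move=> mC C0; rewrite product_measure1E//; last exact: measurableX.
rewrite [X in (X * _)%E](_ : _ = 0%E) ?mul0e//.
have /= -> := @product_measure1E _ _ _ _ R leb leb setT C measurableT mC.
by rewrite [X in (_ * X)%E](_ : _ = 0%E) ?mule0.
Qed.

(** By Fubini: a vertical section of the graph has at most one point. *)
Lemma leb3_graph_null f : continuous_excursion_type f ->
  leb3 (((`[0, 1]%classic `*` setT) `&` [set u | u.2 = f u.1]) `*` setT) = 0%E.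
Proof.
move=> hf; rewrite product_measure1E//; last exact: measurable_graph.
rewrite [X in (X * _)%E](_ : _ = 0%E) ?mul0e//.
rewrite /product_measure1 /=; apply: integral0_eq => s _ /=.
apply: (@subset_measure0 _ _ _ leb _ [set f s]) => //.
- by apply: measurable_xsection; exact: measurable_graph.
- by move=> t /xsectionP/= [].
- exact: lebesgue_measure_set1.
Qed.

End intensities.

Section grid_intensities.
Context {R : realType}.
Variables (c : R) (m n : nat).
Hypotheses (c0 : 0 < c) (m0 : (0 < m)%N) (n0 : (0 < n)%N).
Implicit Types (f : R -> R) (u : R * R) (p : R * R * R) (x : nat * nat * nat).

Local Notation leb := (@lebesgue_measure R).
Local Notation leb3 := ((leb \x leb) \x leb)%E.

Let h_gt0 : 0 < c / n%:R. Proof. by rewrite divr_gt0// ltr0n. Qed.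

Definition cell_box (S : R) (k : nat) : set (R * R * R) :=
  ((`[0, 1] `*` `[0, S]) `*`
    `[k%:R * (c / n%:R), k%:R * (c / n%:R) + c / n%:R])%classic.

Lemma measurable_cell_box S k : measurable (cell_box S k).
Proof. by apply: measurableX; [apply: measurableX|]; exact: measurable_itv. Qed.

Lemma region_box f S x : (forall s, 0 <= s <= 1 -> f s <= S) ->
  region c m n f x `<=` cell_box S x.2.
Proof.
move=> fS p [[/andP[u0 u1] /andP[t0 tf]] p0 <-] /=.
have /andP[k1 k2] : (Num.truncn (p.2 / (c / n%:R)))%:R <= p.2 / (c / n%:R) <
    (Num.truncn (p.2 / (c / n%:R))).+1%:R.
  by apply: truncn_itv; rewrite divr_ge0// ltW.
rewrite /cell_box; split; rewrite /= ?in_itv/=; first split; rewrite /= ?in_itv/=.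
- by rewrite !ltW.
- by rewrite t0/= (le_trans (ltW tf))// fS// !ltW.
- rewrite -ler_pdivlMr// k1/=; move: k2; rewrite ltr_pdivrMr// -natr1 mulrDl mul1r.
  exact: ltW.
Qed.

(** The number of configuration points in this set is the number of long chords that appear in time
    cell k. *)
Definition slab f (k : nat) : set (R * R * R) :=
  [set p | exists2 x, long x /\ x.2 = k & region c m n f x p].

Lemma measurable_slab f k : continuous_excursion_type f -> measurable (slab f k).
Proof.
move=> hf.
have -> : slab f k = \bigcup_i \bigcup_j
    (if long (i, j, k) then region c m n f (i, j, k) else set0).
  apply/seteqP; split => p.
    by move=> [[[i j] k'] [lx /= <-] rp]; exists i => //; exists j => //; rewrite lx.
  move=> [i _ [j _]]; case: ifPn => // lx rp.
  by exists (i, j, k).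
apply: bigcupT_measurable => i; apply: bigcupT_measurable => j.
by case: ifPn => // _; exact: measurable_region.
Qed.

Lemma intensity_ge0 f A : continuous_excursion_type f -> (0 <= intensity f A)%E.
Proof. by move=> hf; apply: integral_ge0 => p _; rewrite lee_fin density_ge0. Qed.

(** The density is at most 2 m on long chords, and the slab lies in a box of volume S c / n. *)
Lemma intensity_slab f S k : continuous_excursion_type f -> 0 <= S ->
  (forall s, 0 <= s <= 1 -> f s <= S) ->
  (intensity f (slab f k) <= (2 * m%:R * S * (c / n%:R))%:E)%E.
Proof.
move=> hf S0 fS.
have := @intensity_le R f (slab f k) (cell_box S k) (2 * m%:R) hf.
rewrite leb3_box ?(ltW h_gt0)// -EFinM -[2 * m%:R * S * _]mulrA; apply.
- exact: measurable_slab.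
- exact: measurable_cell_box.
- by move=> p [x _ /region_timed_EG].
- by move=> p [x [_ <-] /(region_box fS)].
- by rewrite mulr_ge0.
- by move=> p [x [lx _] rp]; apply: density_long rp lx.
Qed.

Lemma intensity_region_fin f S x : continuous_excursion_type f -> 0 <= S ->
  (forall s, 0 <= s <= 1 -> f s <= S) -> long x ->
  intensity f (region c m n f x) \is a fin_num.
Proof.
move=> hf S0 fS lx; rewrite ge0_fin_numE ?intensity_ge0//.
apply: (@le_lt_trans _ _ (2 * m%:R * S * (c / n%:R))%:E); last exact: ltry.
apply: le_trans (intensity_slab x.2 hf S0 fS).
have mS := measurable_slab x.2 hf; have mR := measurable_region m c0 n0 x hf.
apply: ge0_subset_integral => //.
- apply/measurable_EFinP; apply: measurable_funS (measurable_density hf) => //.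
    exact: measurable_timed_EG.
  by move=> p [y _ /region_timed_EG].
- by move=> p _; rewrite lee_fin density_ge0.
- by move=> p rp; exists x.
Qed.

Section convergence.
Variables (f_ : nat -> R -> R) (f : R -> R) (S : R).
Hypotheses (hf_ : forall n, continuous_excursion_type (f_ n))
  (hf : continuous_excursion_type f) (f0 : f 0 = 0).
Hypothesis f_f : forall e, 0 < e ->
  \forall n \near \oo, forall s, 0 <= s <= 1 -> `|f s - f_ n s| < e.
Hypotheses (S0 : 0 <= S) (fS : forall s, 0 <= s <= 1 -> f s <= S)
  (f_S : forall n s, 0 <= s <= 1 -> f_ n s <= S).

(** The domain of integration varies with k, so the integrals are extended to the whole space. The
    common bound S places all the regions in one box, and 2 m times its indicator dominates. *)
Lemma intensity_region_cvg x : long x ->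
  intensity (f_ k) (region c m n (f_ k) x) @[k --> \oo] -->
  intensity f (region c m n f x).
Proof.
move=> lx; set box := cell_box S x.2.
have mbox : measurable box by exact: measurable_cell_box.
pose G (g : R -> R) p : \bar R := ((intensity_density g \_ (region c m n g x)) p)%:E.
have IG g : intensity g (region c m n g x) = (\int[leb3]_p G g p)%E.
  rewrite /intensity integral_mkcond; apply: eq_integral => p _.
  by rewrite /G !patchE; case: ifP.
have mG g : continuous_excursion_type g -> measurable_fun setT (G g).
  move=> hg; apply/measurable_EFinP.
  have mr := measurable_region m c0 n0 x hg.
  apply: (measurable_restrictT (intensity_density g) mr).1.
  apply: (measurable_funS (measurable_timed_EG hg) _ (measurable_density hg)).
  exact: region_timed_EG.
rewrite IG; under eq_fun do rewrite IG.
pose B p : \bar R := ((2 * m%:R) * \1_box p)%:E.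
have boxfin : (leb3 box < +oo)%E by rewrite leb3_box ?(ltW h_gt0)// ltry.
have iB : leb3.-integrable setT B.
  rewrite (_ : B = (fun p => (2 * m%:R)%:E * (\1_box p)%:E)%E); last first.
    by apply/funext => p; rewrite /B EFinM.
  apply: integrableZl => //.
  apply/integrableP; split; first by apply/measurable_EFinP; exact: measurable_indic.
  under eq_integral do rewrite gee0_abs ?lee_fin//.
  by rewrite integral_indic// setIT.
have GB g : continuous_excursion_type g -> (forall s, 0 <= s <= 1 -> g s <= S) ->
    forall p, (`|G g p| <= B p)%E.
  move=> hg gS p; rewrite /G /B patchE lee_fin indicE; case: ifPn => [|_].
    rewrite inE => rp; rewrite mem_set ?mulr1; last exact: (region_box gS).
    by rewrite ger0_norm ?density_ge0// (density_long _ _ rp).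
  by rewrite normr0 !mulr_ge0.
have ae_cvg : {ae leb3, forall p, setT p -> G (f_ k) p @[k --> \oo] --> G f p}.
  have mC : measurable (bad_levels f m).
    by apply: countable_measurable => //; exact: countable_bad_levels.
  have C0 : leb (bad_levels f m) = 0%E.
    by apply: countable_lebesgue_measure0; exact: countable_bad_levels.
  have neg : leb3.-negligible ((setT `*` bad_levels f m) `*` setT `|`
      ((`[0, 1]%classic `*` setT) `&` [set u | u.2 = f u.1]) `*` setT).
    apply: negligibleU.
      apply/negligibleP; last exact: leb3_level_null.
      by apply: measurableX => //; exact: measurableX.
    apply/negligibleP; last exact: leb3_graph_null.
    by apply: measurableX => //; exact: measurable_graph.
  apply: negligibleS neg => p /= /not_implyP[_ np].
  apply: contrapT => /not_orP[nb ng]; apply: np.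
  have nbad : ~ bad_levels f m p.1.2 by move=> h; apply: nb.
  have [p01|p01] := boolP (0 <= p.1.1 <= 1).
    have nfp : p.1.2 != f p.1.1.
      by apply/eqP => e; apply: ng; split => //; split => //; split; rewrite //= in_itv.
    apply: cvg_EFin; first by near=> k.
    exact: density_cvg.
  have nE g : ~ EG g p.1.
    by move=> [/andP[u0 u1] _]; move/negP: p01; apply; rewrite !ltW.
  have G0 g : G g p = 0%E by rewrite /G patchE memNset// => -[/nE].
  by rewrite G0; under eq_fun do rewrite G0; exact: cvg_cst.
have ae_dom : {ae leb3, forall p k, setT p -> (`|G (f_ k) p| <= B p)%E}.
  by apply: aeW => p k _; apply: GB => // s; exact: f_S.
have mGf : measurable_fun setT (G f) by exact: mG.
by have [_ _] := @dominated_convergence _ _ R leb3 setT measurableT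
  (fun k => G (f_ k)) (G f) B (fun k => mG _ (hf_ k)) mGf ae_cvg iB ae_dom.
Unshelve. all: by end_near. Qed.

End convergence.

End grid_intensities.

(** * Poisson point processes *)

Section counting_facts.
Context {R : realType} {T : choiceType}.
Implicit Types A : set T.

Lemma counting_eq0 A : (counting A = 0%E :> \bar R) <-> A = set0.
Proof.
rewrite /counting; case: asboolP => finA; split.
- move=> [/eqP]; rewrite pnatr_eq0 finmap.cardfs_eq0 => /eqP A0.
  by rewrite -(fset_setK finA) A0 set_fset0.
- by move=> ->; rewrite fset_set0 finmap.cardfs0.
- by [].
- by move=> A0; exfalso; apply: finA; rewrite A0; exact: finite_set0.
Qed.

Lemma counting_le1 A : (counting A = 0%E :> \bar R) \/ (counting A = 1%:R%:E :> \bar R) ->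
  finite_set A /\ forall p q, A p -> A q -> p = q.
Proof.
case=> [/counting_eq0 ->|]; first by split.
rewrite /counting; case: asboolP => // finA [/eqP]; rewrite eqr_nat => /finmap.cardfs1P[x xE].
split=> //; have AE : A = [set x] by rewrite -(fset_setK finA) xE set_fset1.
by rewrite AE => p q -> ->.
Qed.

End counting_facts.

Section poisson.
Context {R : realType} {d d'} {Om : measurableType d} {T : measurableType d'}.
Variables (P : probability Om R) (mu : set T -> \bar R) (Pi : Om -> set T).
Hypothesis ppp : poisson_point_process P mu Pi.
Implicit Types A : set T.

Lemma measurable_count A (B : set (\bar R)) : measurable A -> measurable B ->
  measurable [set w | B (point_count Pi A w)].
Proof.
move=> mA mB; have := ppp_measurable ppp mA measurableT mB.
by rewrite setTI.
Qed.

Lemma measurable_count_eq A (y : \bar R) : measurable A ->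
  measurable [set w | point_count Pi A w = y].
Proof. by move=> mA; exact: (measurable_count mA (emeasurable_set1 y)). Qed.

Lemma measurable_neq0e : measurable [set y : \bar R | y != 0%E].
Proof.
rewrite (_ : [set y | _] = ~` [set 0%E]); last by apply/seteqP; split => y /= /eqP.
exact/measurableC/emeasurable_set1.
Qed.

Lemma ppp_void A : measurable A -> (mu A < +oo)%E ->
  P [set w | point_count Pi A w = 0%E :> \bar R] = (expR (- fine (mu A)))%:E.
Proof.
move=> mA Afin; have := ppp_poisson ppp mA Afin 0.
by rewrite expr0 fact0 mulr1 divr1.
Qed.

Lemma ppp_nonvoid A : measurable A -> (mu A < +oo)%E ->
  P [set w | point_count Pi A w != 0%E :> \bar R] = (1 - expR (- fine (mu A)))%:E.
Proof.
move=> mA Afin; rewrite (_ : [set w | _] = ~` [set w | point_count Pi A w = 0%E :> \bar R]).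
  by rewrite probability_setC ?ppp_void//; exact: measurable_count_eq.
by apply/seteqP; split => w /= /eqP.
Qed.

(** For a Poisson variable of mean x, the probability 1 - e^{-x} (1 + x) of at least two points is
    at most 1 - (1 - x) (1 + x) = x^2. *)
Lemma ppp_at_most_one A (b : R) : measurable A -> (0 <= mu A)%E -> (mu A <= b%:E)%E ->
  (P (~` [set w | point_count Pi A w = 0%E :> \bar R \/
                  point_count Pi A w = 1%:R%:E :> \bar R]) <= (b ^+ 2)%:E)%E.
Proof.
move=> mA A0 Ab; have Afin : (mu A < +oo)%E by rewrite (le_lt_trans Ab) ?ltry.
have m0 := measurable_count_eq 0%E mA; have m1 := measurable_count_eq 1%:R%:E mA.
set A0' := [set w | point_count Pi A w = 0%E :> \bar R] in m0.
set A1' := [set w | point_count Pi A w = 1%:R%:E :> \bar R] in m1.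
have -> : P (~` (A0' `|` A1')) = (1 - (P A0' + P A1'))%E.
  rewrite probability_setC; last exact: measurableU.
  congr (_ - _)%E; apply: measureU => //.
  rewrite -subset0 => w []; rewrite /A0' /A1' /= => -> [/esym/eqP].
  by rewrite oner_eq0.
have -> : P A0' = (expR (- fine (mu A)))%:E by exact: ppp_void.
have -> := ppp_poisson ppp mA Afin 1.
set x := fine (mu A).
have x0 : 0 <= x by exact: fine_ge0.
have xb : x <= b by rewrite -lee_fin fineK// ge0_fin_numE.
rewrite [leLHS](_ : _ = (1 - (expR (- x) + expR (- x) * x))%:E); last first.
  by rewrite /= expr1 divr1.
rewrite lee_fin.
have e1 : 1 - x <= expR (- x) by exact: expR_ge1Dx.
have : 1 - (expR (- x) + expR (- x) * x) <= x ^+ 2 by nra.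
by move/le_trans; apply; rewrite ler_pXn2r// nnegrE// (le_trans x0).
Qed.

Definition void_prob (b : bool) (y : \bar R) : R :=
  if b then 1 - expR (- fine y) else expR (- fine y).

Lemma ppp_pattern (I : finType) (A : I -> set T) (b : {ffun I -> bool}) :
  (forall i, measurable (A i)) -> trivIset setT A -> (forall i, (mu (A i) < +oo)%E) ->
  P [set w | forall i, (point_count Pi (A i) w != 0%E :> \bar R) = b i] =
  (\prod_i void_prob (b i) (mu (A i)))%:E.
Proof.
move=> mA tA finA.
pose B i : set (\bar R) := [set y | (y != 0%E) = b i].
have mB i : measurable (B i).
  rewrite /B; case: (b i).
    rewrite (_ : [set y | _] = [set y | y != 0%E]); first exact: measurable_neq0e.
    by apply/seteqP; split => y.
  rewrite (_ : [set y | _] = [set 0%E]); first exact: emeasurable_set1.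
  by apply/seteqP; split => y /= => [/negbFE/eqP|->]; rewrite ?eqxx.
(* Independence is stated for families indexed by ordinals; it is transported along the enumeration
   of [I]. *)
have := @ppp_independent _ _ _ _ _ _ _ _ ppp #|I| (A \o enum_val) (B \o enum_val)
  (fun i => mA _) _ (fun i => mB _).
rewrite (_ : [set w | forall i : 'I_#|I|, _] =
  [set w | forall i, (point_count Pi (A i) w != 0%E :> \bar R) = b i]); last first.
  apply/seteqP; split => w /= H i; last exact: H.
  by have := H (enum_rank i); rewrite enum_rankK.
move=> ->; last first.
  by move=> i j _ _ ij; apply: enum_val_inj; exact: tA.
rewrite -prodEFin [RHS](reindex (enum_val (A := I)))/=; last first.
  exact/onW_bij/enum_val_bij.
apply: eq_bigr => i _.
rewrite /B /void_prob /=; case: (b _).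
  exact: ppp_nonvoid.
rewrite -ppp_void//; congr (P _); apply/seteqP; split => w /= => [/negbFE/eqP//|->].
by rewrite eqxx.
Qed.

Lemma measurable_pattern (I : finType) (A : I -> set T) (b : {ffun I -> bool}) :
  (forall i, measurable (A i)) ->
  measurable [set w | forall i, (point_count Pi (A i) w != 0%E :> \bar R) = b i].
Proof.
move=> mA.
rewrite (_ : [set w | _] = \bigcap_(i in [set: I])
  [set w | (point_count Pi (A i) w != 0%E :> \bar R) = b i]); last first.
  by apply/seteqP; split => w H i => [_|]; apply: H.
apply: fin_bigcap_measurable => // i _.
case: (b i).
  rewrite (_ : [set w | _] = ~` [set w | point_count Pi (A i) w = 0%E :> \bar R]).
    exact/measurableC/measurable_count_eq.
  by apply/seteqP; split => w /= /eqP.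
rewrite (_ : [set w | _] = [set w | point_count Pi (A i) w = 0%E :> \bar R]).
  exact: measurable_count_eq.
by apply/seteqP; split => w /= => [/negbFE/eqP//|->]; rewrite eqxx.
Qed.

End poisson.

Section finite_expectation.
Context {R : realType} {d} {Om : measurableType d} {F : finType}.
Variables (P : probability Om R) (b : Om -> F).
Hypothesis mb : forall y, measurable (b @^-1` [set y]).

Lemma measurable_finite_preimage (B : set F) : measurable (b @^-1` B).
Proof.
rewrite (_ : b @^-1` B = \bigcup_(y in B) (b @^-1` [set y])).
  by apply: fin_bigcup_measurable => //; exact: finite_finset.
apply/seteqP; split => [w Bw|w [y By bw]]; first by exists (b w).
by rewrite /preimage/= bw.
Qed.

Lemma expectation_finite (h : F -> R) :
  ('E_P[h \o b] = \sum_(y : F) (h y)%:E * P (b @^-1` [set y]))%E.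
Proof.
rewrite unlock; transitivity
  (\int[P]_w (\sum_(y : F) ((h y)%:E * (\1_(b @^-1` [set y]) w)%:E)))%E.
  apply: eq_integral => w _; rewrite (bigD1 (b w))//= big1 ?adde0.
    by rewrite indicE mem_set//= mule1.
  by move=> y yb; rewrite indicE memNset ?mule0// => /= e; rewrite e eqxx in yb.
rewrite integral_sum//=; last first.
  by move=> y; apply: integrableZl => //; exact: integrable_indic.
apply: eq_bigr => y _; rewrite integralZl//; last exact: integrable_indic.
by rewrite integral_indic// setIT.
Qed.

End finite_expectation.

(** * The lamination process *)

Section configurations.
Context {R : realType}.
Variables (f : R -> R) (hf : continuous_excursion_type f) (c : R) (c0 : 0 < c).
Implicit Types (N : set (R * R * R)) (p : R * R * R) (x : nat * nat * nat).

(** Points off [EG f] are discarded so that the chords are parallel for every configuration; almost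
    surely there are no such points. *)
Definition marks N : set (R * R * R) :=
  exc_mark f @` (N `&` [set p | EG f p.1 /\ 0 <= p.2 <= c]).

Definition off_EG : set (R * R * R) := ~` EG f `*` setT.

Definition grid_times n : set (R * R * R) :=
  setT `*` range (fun k : nat => k%:R * (c / n%:R)).

(** The first two clauses hold almost surely. The third is the one whose failure has to be made
    unlikely: at most one long chord per time cell. *)
Definition good m n N := [/\ counting (N `&` off_EG) = 0%E :> \bar R,
  counting (N `&` grid_times n) = 0%E :> \bar R &
  forall k, (k < n)%N -> counting (N `&` slab c m n f k) = 0%E :> \bar R \/
    counting (N `&` slab c m n f k) = 1%:R%:E :> \bar R].

Lemma marks_unit N p : marks N p -> in_unit p.1.
Proof. by move=> [q [_ [Eq _]] <-]; exact: exc_in_unit. Qed.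

Lemma marks_parallel N p q : marks N p -> marks N q -> parallel p.1 q.1.
Proof.
by move=> [p' [_ [Ep _]] <-] [q' [_ [Eq _]] <-]; exact: exc_parallel.
Qed.

Section at_scale.
Variables (m n : nat).
Hypotheses (m0 : (0 < m)%N) (n0 : (0 < n)%N).

Let h_gt0 : 0 < c / n%:R. Proof. by rewrite divr_gt0// ltr0n. Qed.

Lemma good_EG N p : good m n N -> N p -> EG f p.1.
Proof.
move=> [/counting_eq0 + _ _] Np; rewrite -subset0 => /(_ p) H.
by apply: contrapT => nE; apply: H.
Qed.

Lemma good_time N p k : good m n N -> N p -> p.2 <> k%:R * (c / n%:R).
Proof.
move=> [_ /counting_eq0 + _] Np pk; rewrite -subset0 => /(_ p); apply.
by split => //; split => //; exists k.
Qed.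

Lemma good_slab N k : good m n N -> (k < n)%N ->
  finite_set (N `&` slab c m n f k) /\
  forall p q, (N `&` slab c m n f k) p -> (N `&` slab c m n f k) q -> p = q.
Proof. by move=> [_ _ H] kn; apply: (@counting_le1 R); exact: H. Qed.

(** The time c would fall in cell n, beyond the last one; it is a grid time and hence excluded. *)
Lemma time_cell_lt p : 0 <= p.2 <= c -> p.2 <> n%:R * (c / n%:R) ->
  ((cell c m n (exc_mark f p)).2 < n)%N.
Proof.
move=> /andP[p0 pc] pn; rewrite /cell/= truncn_lt_nat; last by rewrite divr_ge0// ltW.
rewrite ltr_pdivrMr// lt_neqAle; apply/andP; split; first exact/eqP.
by rewrite mulrC divfK// gt_eqF// ltr0n.
Qed.

Lemma good_long_mark N p : good m n N -> marks N p -> long (cell c m n p) ->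
  exists q, [/\ (N `&` slab c m n f (cell c m n p).2) q, exc_mark f q = p &
    ((cell c m n p).2 < n)%N].
Proof.
move=> gN [q [Nq [Eq q0c]] <-] lq; exists q; split => //.
  split => //; exists (cell c m n (exc_mark f q)) => //.
  by split => //; case/andP: q0c.
by apply: time_cell_lt => //; exact: good_time Nq.
Qed.

Lemma good_well_spread N : good m n N -> well_spread c m n (marks N).
Proof.
move=> gN; split.
- by move=> _ [q [_ [_ q0c]] <-].
- by move=> _ k [q [Nq _] <-] /=; exact: good_time Nq.
- move=> p q Mp Mq lp lq pq.
  have [p' [Np pE kn]] := good_long_mark gN Mp lp.
  have [q' [Nq qE _]] := good_long_mark gN Mq lq.
  rewrite -pq in Nq; have [_ /(_ _ _ Np Nq) pq'] := good_slab gN kn.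
  by rewrite -pE -qE pq'.
Qed.

Lemma good_finite_long N : good m n N ->
  finite_set [set p | marks N p /\ long (cell c m n p)].
Proof.
move=> gN; apply: (@sub_finite_set _ _
    (\bigcup_(k in `I_n) (exc_mark f @` (N `&` slab c m n f k)))).
  move=> p [Mp lp]; have [q [Nq qp kn]] := good_long_mark gN Mp lp.
  by exists (cell c m n p).2 => //; exists q.
apply: bigcup_finite => // k kn; apply: finite_image.
by have [] := good_slab gN kn.
Qed.

End at_scale.

(** A good scale has at most one long chord per time cell, hence finitely many, and every chord with
    d - g > 2 / m is long. Good scales with m arbitrarily large reach every threshold e. *)
Lemma good_marked_laminar N :
  (forall j : nat, exists m n, [/\ (j <= m)%N, (0 < m)%N, (0 < n)%N & good m n N]) ->
  marked_laminar (marks N).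
Proof.
move=> goods; split; [exact: marks_unit|exact: marks_parallel|].
move=> e e0; have [m [n [jm m0 n0 gN]]] := goods (Num.truncn (2 / e)).+1.
apply: sub_finite_set (good_finite_long n0 gN) => p [Mp ep]; split => //.
apply: contraT => /(short_cell m0 (marks_unit Mp)).
move/(lt_le_trans ep); rewrite ltr_pdivlMr ?ltr0n// mulrC -ltr_pdivlMr// => m2e.
have := truncnS_gt (2 / e); rewrite ltNge => /negP[].
by rewrite (le_trans _ (ltW m2e))// ler_nat.
Qed.

Lemma lamination_at_marks N t : (forall p, N p -> EG f p.1) -> t <= c ->
  lamination_at f N t = lamset (before (marks N) t).
Proof.
move=> NE tc; rewrite /lamination_at /lamset; congr (_ `|` _).
apply/seteqP; split => z.
  move=> [_ [p [Np /= /andP[p0 pt]] <-] zp]; exists (exc_g f p.1, exc_d f p.1) => //.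
  exists (exc_mark f p) => //; split => //; exists p => //; split => //.
  by split; [exact: NE|rewrite p0 (le_trans pt)].
move=> [_ [_ [[p [Np [Ep /andP[p0 pc]]] <-] /= pt] <-] zp].
by exists p.1 => //; exists p => //=; rewrite p0.
Qed.

End configurations.

Section patterns.
Context {R : realType}.
Variables (c : R) (c0 : 0 < c).
Implicit Types (f : R -> R) (N : set (R * R * R)) (p : R * R * R) (x : nat * nat * nat).

Lemma marked_laminar0 : marked_laminar (set0 : set (R * R * R)).
Proof. by split => // e _; apply: (@sub_finite_set _ _ set0) => // p []. Qed.

(** It has to be total, since a pattern of bits produced by no configuration may encode crossing
    chords; the path without chords is then the value. *)
Definition marks_path K : skorokhod (lamination R) c :=
  if pselect (marked_laminar K) is left HK then lam_path c HK
  else lam_path c marked_laminar0.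

Lemma marks_pathE K (HK : marked_laminar K) : marks_path K = lam_path c HK.
Proof.
rewrite /marks_path; case: pselect => // HK'.
by congr lam_path; exact: Prop_irrelevance.
Qed.

(** d = 1 falls in space cell m, hence m + 1 space cells; the time c is ruled out by [good], hence n
    time cells. *)
Definition cell_index m n := ('I_m.+1 * 'I_m.+1 * 'I_n)%type.

Definition index_cell m n (i : cell_index m n) : nat * nat * nat :=
  (val i.1.1, val i.1.2, val i.2).

(** A short cell may have infinite intensity. With the empty set in its place, every bit has a
    finite parameter. *)
Definition index_region m n f (i : cell_index m n) : set (R * R * R) :=
  if long (index_cell i) then region c m n f (index_cell i) else set0.

Definition pattern m n f N : {ffun cell_index m n -> bool} :=
  [ffun i => counting (N `&` index_region f i) != 0%E :> \bar R].

Definition pattern_path m n (b : {ffun cell_index m n -> bool}) :=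
  marks_path (cell_point c m n @` (@index_cell m n @` [set i | b i])).

Lemma good_pattern m n f N : continuous_excursion_type f -> (0 < m)%N -> (0 < n)%N ->
  good f c m n N ->
  discretize c m n (marks f c N) =
  cell_point c m n @` (@index_cell m n @` [set i | pattern m n f N i]).
Proof.
move=> hf m0 n0 gN; congr (_ @` _); have m_gt0 : 0 < m%:R :> R by rewrite ltr0n.
have h_gt0 : 0 < c / n%:R by rewrite divr_gt0// ltr0n.
apply/seteqP; split => x.
  move=> [[_ [p [Np [Ep p0c]] <-] px] /= lx].
  have [g0 gd d1] := exc_in_unit hf Ep; rewrite /= in g0 gd d1.
  have tm (y : R) : 0 <= y -> y <= 1 -> (Num.truncn (m%:R * y) < m.+1)%N.
    move=> y0 y1; rewrite truncn_lt_nat ?mulr_ge0// -natr1.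
    by rewrite (@le_lt_trans _ _ m%:R) ?ltrDl// ler_piMr.
  have k1 := tm _ g0 (le_trans gd d1); have k2 := tm _ (le_trans g0 gd) d1.
  have k3 : ((cell c m n (exc_mark f p)).2 < n)%N.
    by apply: time_cell_lt => //; exact: good_time gN Np.
  pose i : cell_index m n := (Ordinal k1, Ordinal k2, Ordinal k3).
  have ix : index_cell i = x by rewrite -px.
  exists i => //; rewrite /= ffunE; apply/eqP => /counting_eq0.
  rewrite -subset0 => /(_ p); apply; split => //.
  have lx' : long x := lx.
  rewrite /index_region ix lx'; split => //.
  by case/andP: p0c.
move=> [i /= + <-]; rewrite ffunE => ni.
have : N `&` index_region f i !=set0.
  by apply/set0P; apply: contraNN ni => /eqP/counting_eq0 ->.
move=> [p [Np]]; rewrite /index_region; case: ifPn => // li [Ep p0 ci].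
split => //=; exists (exc_mark f p) => //; exists p => //; split => //; split => //.
rewrite p0/=; apply: ltW.
have : (Num.truncn (p.2 / (c / n%:R)) < n)%N.
  by have := congr1 snd ci; rewrite /cell/= => ->; exact: ltn_ord.
rewrite truncn_lt_nat; last by rewrite divr_ge0// ltW.
by rewrite ltr_pdivrMr// mulrCA divff ?mulr1// gt_eqF// ltr0n.
Qed.

Lemma good_j1 m n f N e : continuous_excursion_type f -> (0 < m)%N -> (0 < n)%N ->
  good f c m n N -> marked_laminar (marks f c N) -> c / n%:R < e -> 8 * pi / m%:R < e ->
  j1_ball (marks_path (marks f c N)) e (pattern_path (pattern m n f N)).
Proof.
move=> hf m0 n0 gN HK he me; rewrite /pattern_path -good_pattern// (marks_pathE HK).
rewrite (marks_pathE (discretize_marked_laminar c n m0 HK)).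
apply: path_discretize => //; exact: good_well_spread.
Qed.

End patterns.

Section borel_limits.
Context {R : realType} d {Om : measurableType d} {S : pseudoMetricType R}.

Lemma borel_measurable_open (X : Om -> S) :
  (forall U, open U -> measurable (X @^-1` U)) -> borel_measurable X.
Proof.
move=> H B; apply: (@smallest_sub _ _ _ [set B : set S | measurable (X @^-1` B)]); last first.
  by move=> U /= /H.
split => [|A mA|F mF] /=.
- by rewrite preimage_set0.
- by rewrite setTD -preimage_setC; exact: measurableC.
- by rewrite preimage_bigcup; exact: bigcupT_measurable.
Qed.

(* An open set U is the union of the sets [U_ j] of the points at distance at least 1 / (j + 1)
   from its complement, and X w is in U iff the X_ k w eventually are in some [U_ j]. *)
Lemma borel_measurable_limit (X : Om -> S) (X_ : nat -> Om -> S) :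
  (forall k B, measurable (X_ k @^-1` B)) ->
  (forall w e, 0 < e -> \forall k \near \oo, ball (X w) e (X_ k w)) ->
  borel_measurable X.
Proof.
move=> mX_ X_X; apply: borel_measurable_open => U oU.
pose U_ (j : nat) : set S := [set y | ball y j.+1%:R^-1 `<=` U].
have -> : X @^-1` U = \bigcup_j \bigcup_i \bigcap_(k in [set k | (i <= k)%N]) (X_ k @^-1` U_ j).
  apply/seteqP; split => w /=.
    move=> Uw; have /nbhs_ballP[e /= e0 eU] : nbhs (X w) U by exact: open_nbhs_nbhs.
    have e20 : 0 < e / 2 by rewrite divr_gt0.
    (* This j gives 1 / (j + 1) <= e / 2, so two successive steps stay within e of [X w]. *)
    exists (Num.truncn (2 / e)) => //.
    have [i _ Hi] := X_X w _ e20; exists i => // k /= ik y yb.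
    apply: eU; rewrite (splitr e); apply: ball_triangle (Hi k ik) _.
    apply: le_ball yb; rewrite -[leRHS]invrK lef_pV2 ?posrE ?invr_gt0//.
    by rewrite invf_div ltW// truncnS_gt.
  move=> [j _ [i _ H]].
  have j0 : 0 < j.+1%:R^-1 :> R by rewrite invr_gt0.
  have [l _ Hl] := X_X w _ j0.
  apply: (H (maxn i l)) => /=; first exact: leq_maxl.
  by apply: ball_sym; apply: Hl => /=; exact: leq_maxr.
apply: bigcupT_measurable => j; apply: bigcupT_measurable => i.
by apply: bigcap_measurable => [|k _]; [exists i => /=|exact: mX_].
Qed.

End borel_limits.

(** * Probability of good scales and existence of the process *)

Section good_events.
Context {R : realType} d {Om : measurableType d}.
Variables (f : R -> R) (S c : R).
Hypotheses (hf : continuous_excursion_type f) (S0 : 0 <= S)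
  (fS : forall s, 0 <= s <= 1 -> f s <= S) (c0 : 0 < c).
Variables (P : probability Om R) (N : Om -> set (R * R * R)).
Hypothesis hN : poisson_point_process P (intensity f) N.

Lemma measurable_off_EG : measurable (off_EG f).
Proof. by apply: measurableX => //; apply: measurableC; exact: measurable_EG. Qed.

Lemma intensity_off_EG : intensity f (off_EG f) = 0%E.
Proof.
apply: intensity0 => //; first exact: measurable_off_EG.
by move=> p [nE _]; rewrite /intensity_density indicE memNset// mulr0 mul0r.
Qed.

Let countable_times n : countable (range (fun k : nat => k%:R * (c / n%:R) : R)).
Proof. exact: (card_le_trans (card_image_le _ _) (countableP _)). Qed.

Lemma measurable_grid_times n : measurable (grid_times c n).
Proof. by apply: measurableX => //; exact: countable_measurable. Qed.

Lemma intensity_grid_times n : intensity f (grid_times c n) = 0%E.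
Proof.
apply: intensity_null => //; first exact: measurable_grid_times.
by apply: leb3_time_null; [exact: countable_measurable|exact: countable_lebesgue_measure0].
Qed.

Section at_scale.
Variables (m n : nat).
Hypotheses (m0 : (0 < m)%N) (n0 : (0 < n)%N).

Let at_most_one k : set Om :=
  [set w | point_count N (slab c m n f k) w = 0%E :> \bar R \/
           point_count N (slab c m n f k) w = 1%:R%:E :> \bar R].

Let measurable_at_most_one k : measurable (at_most_one k).
Proof.
apply: measurableU; apply: (measurable_count_eq hN); exact: measurable_slab.
Qed.

Let goodE : [set w | good f c m n (N w)] =
  [set w | point_count N (off_EG f) w = 0%E :> \bar R] `&`
  [set w | point_count N (grid_times c n) w = 0%E :> \bar R] `&`
  \bigcap_(k in `I_n) at_most_one k.
Proof. by apply/seteqP; split => w /= [[] //]. Qed.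

Lemma measurable_good : measurable [set w | good f c m n (N w)].
Proof.
rewrite goodE; apply: measurableI; first apply: measurableI.
- by apply: (measurable_count_eq hN); exact: measurable_off_EG.
- by apply: (measurable_count_eq hN); exact: measurable_grid_times.
- by apply: fin_bigcap_measurable => //; exact: finite_II.
Qed.

Lemma prob_not_good : (P (~` [set w | good f c m n (N w)]) <=
  (n%:R * (2 * m%:R * S * (c / n%:R)) ^+ 2)%:E)%E.
Proof.
pose E1 := ~` [set w | point_count N (off_EG f) w = 0%E :> \bar R].
pose E2 := ~` [set w | point_count N (grid_times c n) w = 0%E :> \bar R].
have mE1 : measurable E1.
  by apply/measurableC/(measurable_count_eq hN); exact: measurable_off_EG.
have mE2 : measurable E2.
  by apply/measurableC/(measurable_count_eq hN); exact: measurable_grid_times.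
have void0 (A : set (R * R * R)) : measurable A -> intensity f A = 0%E ->
    P (~` [set w | point_count N A w = 0%E :> \bar R]) = 0%E.
  move=> mA A0; rewrite probability_setC; last exact: (measurable_count_eq hN).
  by rewrite (ppp_void hN)// A0//= oppr0 expR0 subee.
(* Union bound over n + 2 events: the n time cells, then the two null events at the indices n and n
   + 1. *)
pose B k := if (k < n)%N then ~` at_most_one k else if k == n then E1 else E2.
have mB k : measurable (B k).
  by rewrite /B; case: ifP => // _; [exact: measurableC|case: ifP].
have := @content_subadditive _ _ _ P (~` [set w | good f c m n (N w)]) B n.+2
  (fun k _ => mB k) (measurableC measurable_good).
have cover : ~` [set w | good f c m n (N w)] `<=` \big[setU/set0]_(k < n.+2) B k.
  move=> w; rewrite -bigcup_mkord goodE => /not_andP[/not_andP[nw|nw]|].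
  - by exists n => //=; rewrite /B ltnn eqxx.
  - exists n.+1 => //=; rewrite /B ltnNge leqnSn/= ifN//.
    by rewrite gtn_eqF.
  - move=> /existsNP[k /not_implyP[/= kn nk]]; exists k => /=.
      by rewrite (ltn_trans kn)// ltnS leqW.
    by rewrite /B kn.
move=> /(_ cover) /le_trans; apply.
rewrite big_ord_recr big_ord_recr/=.
have -> : P (B n) = 0%E.
  by rewrite /B ltnn eqxx; apply: void0; [exact: measurable_off_EG|exact: intensity_off_EG].
have -> : P (B n.+1) = 0%E.
  rewrite /B ltnNge leqnSn/= ifN ?gtn_eqF//.
  by apply: void0; [exact: measurable_grid_times|exact: intensity_grid_times].
rewrite !adde0; apply: (@le_trans _ _ (\sum_(k < n) ((2 * m%:R * S * (c / n%:R)) ^+ 2)%:E)%E).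
  apply: lee_sum => k _; rewrite /B ltn_ord; apply: (ppp_at_most_one hN).
  - exact: measurable_slab.
  - exact: intensity_ge0.
  - exact: intensity_slab.
by rewrite sumEFin lee_fin sumr_const card_ord [n%:R * _ in leRHS]mulr_natl.
Qed.

End at_scale.

(* With m = k + 1 space cells the event of probability at most n (2 m S c / n)^2 on which two long
   chords share a time cell has to be summable in k, see [steps_bound]. *)
Definition steps (k : nat) : nat :=
  ((Num.truncn ((2 * k.+1%:R * S * c) ^+ 2)).+1 * 2 ^ k.+1)%N.

Lemma steps_gt0 k : (0 < steps k)%N.
Proof. by rewrite muln_gt0 expn_gt0. Qed.

Lemma steps_ge k : (k < steps k)%N.
Proof.
by rewrite (@leq_trans (2 ^ k.+1))//; [rewrite ltnW// ltn_expl|rewrite leq_pmull].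
Qed.

Lemma steps_bound k : (steps k)%:R * (2 * k.+1%:R * S * (c / (steps k)%:R)) ^+ 2 <=
  1 / (2 ^ k.+1)%:R.
Proof.
have s0 : 0 < (steps k)%:R :> R by rewrite ltr0n steps_gt0.
set y := 2 * k.+1%:R * S * c.
have -> : (steps k)%:R * (2 * k.+1%:R * S * (c / (steps k)%:R)) ^+ 2 =
    y ^+ 2 / (steps k)%:R.
  by rewrite /y; move: ((steps k)%:R : R) s0 => z z0; field; rewrite gt_eqF.
rewrite ler_pdivrMr// mul1r mulrC /steps -/y natrM -mulrA divff ?mulr1; last first.
  by rewrite gt_eqF// ltr0n expn_gt0.
exact/ltW/truncnS_gt.
Qed.

(** A common strict upper bound for the two errors of [path_discretize], the time mesh and 8 pi / m
    with m = k + 1. *)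
Definition mesh (k : nat) : R := (c + 8 * pi + 1) / k.+1%:R.

Lemma mesh_gt0 k : 0 < mesh k.
Proof. by rewrite divr_gt0// !addr_gt0// mulr_gt0// pi_gt0. Qed.

Lemma mesh_time k : c / (steps k)%:R < mesh k.
Proof.
have pi0 := pi_gt0 R; apply: (@le_lt_trans _ _ (c / k.+1%:R)).
  by rewrite ler_pM2l// lef_pV2 ?posrE ?ltr0n ?steps_gt0// ler_nat steps_ge.
by rewrite ltr_pM2r ?invr_gt0//; lra.
Qed.

Lemma mesh_space k : 8 * pi / k.+1%:R < mesh k.
Proof. by rewrite ltr_pM2r ?invr_gt0//; move: c0; lra. Qed.

Lemma mesh_cvg0 e : 0 < e -> \forall k \near \oo, mesh k < e.
Proof.
move=> e0; exists (Num.truncn ((c + 8 * pi + 1) / e)) => // k /= ek.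
rewrite /mesh ltr_pdivrMr// [e * _]mulrC -ltr_pdivrMr//.
by rewrite (lt_le_trans (truncnS_gt _))// ler_nat.
Qed.

Definition good_at k : set Om := [set w | good f c k.+1 (steps k) (N w)].

Lemma measurable_good_at k : measurable (good_at k).
Proof. by apply: measurable_good => //; exact: steps_gt0. Qed.

Lemma prob_not_good_at k : (P (~` good_at k) <= (1 / (2 ^ k.+1)%:R)%:E)%E.
Proof.
by apply: le_trans (prob_not_good _ (steps_gt0 k)) _ => //; rewrite lee_fin steps_bound.
Qed.

Definition eventually_good : set Om := ~` lim_sup_set (fun k => ~` good_at k).

Lemma measurable_eventually_good : measurable eventually_good.
Proof.
apply: measurableC; apply: bigcap_measurable => // k _.
by apply: bigcup_measurable => j _; apply: measurableC; exact: measurable_good_at.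
Qed.

(** Borel-Cantelli, the bounds 1 / 2^(k + 1) being summable. *)
Lemma prob_eventually_good : P (~` eventually_good) = 0%E.
Proof.
rewrite setCK; apply: lim_sup_set_cvg0.
  by move=> k; apply: measurableC; exact: measurable_good_at.
apply: (@le_lt_trans _ _ 1%:E); last exact: ltry.
apply: le_trans (epsilon_trick0 xpredT (@ler01 R)).
by apply: lee_nneseries => // k _; exact: prob_not_good_at.
Qed.

Lemma eventually_goodP w : eventually_good w -> exists j, forall k, (j <= k)%N -> good_at k w.
Proof.
move=> /existsNP[j /not_implyP[_ H]]; exists j => k jk.
by apply: contrapT => nk; apply: H; exists k.
Qed.

Lemma eventually_good_laminar w : eventually_good w -> marked_laminar (marks f c (N w)).
Proof.
move=> /eventually_goodP[j H]; apply: good_marked_laminar => // i.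
exists (maxn i j).+1, (steps (maxn i j)); split => //; last exact/H/leq_maxr.
- by rewrite leqW// leq_maxl.
- exact: steps_gt0.
Qed.

Lemma eventually_good_EG w : eventually_good w -> forall p, N w p -> EG f p.1.
Proof. by move=> /eventually_goodP[j /(_ j (leqnn j)) gj] p; exact: (good_EG gj). Qed.

Definition pattern_at k w := pattern c k.+1 (steps k) f (N w).

Lemma good_at_j1 k w : good_at k w -> marked_laminar (marks f c (N w)) ->
  j1_ball (marks_path c (marks f c (N w))) (mesh k) (pattern_path c (pattern_at k w)).
Proof.
move=> gw HK; apply: good_j1 => //; first exact: steps_gt0.
- exact: mesh_time.
- exact: mesh_space.
Qed.

Lemma measurable_pattern_at k b : measurable (pattern_at k @^-1` [set b]).
Proof.
rewrite (_ : _ @^-1` _ = [set w | forall i,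
    (point_count N (index_region c f i) w != 0%E :> \bar R) = b i]).
  apply: (measurable_pattern hN) => i; rewrite /index_region; case: ifP => // _.
  by apply: measurable_region => //; exact: steps_gt0.
apply/seteqP; split => w /=; first by move=> <- i; rewrite ffunE.
by move=> H; apply/ffunP => i; rewrite ffunE; exact: H.
Qed.

(** On [eventually_good], the paths decoded from the patterns converge to the path of the marks.
    They take finitely many values, each on a measurable event, so measurability passes to the
    limit. Elsewhere a constant element of the path space is used. *)
Lemma lamination_process_exists : exists X, lamination_process P f N (X : Om -> skorokhod (lamination R) c).
Proof.
pose X w := marks_path c (if w \in eventually_good then marks f c (N w) else set0).
exists X; split.
  apply: (@borel_measurable_limit R _ _ _ X (fun k w =>
    if w \in eventually_good then pattern_path c (pattern_at k w) else marks_path c set0)).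
    move=> k B; rewrite (_ : _ @^-1` _ =
      eventually_good `&` (pattern_at k @^-1` [set b | B (pattern_path c b)]) `|`
      ~` eventually_good `&` [set w | B (marks_path c set0)]).
      apply: measurableU; apply: measurableI.
      - exact: measurable_eventually_good.
      - by apply: measurable_finite_preimage => b; exact: measurable_pattern_at.
      - exact/measurableC/measurable_eventually_good.
      - have [h|h] := pselect (B (marks_path c set0)).
          by rewrite (_ : [set w | _] = setT)//; apply/seteqP; split => w.
        by rewrite (_ : [set w | _] = set0)//; apply/seteqP; split => w.
    apply/seteqP; split => w /=; case: ifPn.
    - by rewrite inE => ? ?; left.
    - by rewrite notin_setE => ? ?; right.
    - by rewrite inE => gw [[]|[/(_ gw)]].
    - by rewrite notin_setE => gw [[/gw]|[]].
  move=> w e e0; rewrite /X; case: ifPn => [|_]; last by near=> k; exact: ballxx.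
  rewrite inE => gw; have HK := eventually_good_laminar gw.
  have [j H] := eventually_goodP gw; near=> k.
  apply: (@le_ball _ _ _ (mesh k)); first by apply: ltW; near: k; exact: mesh_cvg0.
  by apply: good_at_j1 => //; apply: H; near: k; exact: nbhs_infty_ge.
exists (~` eventually_good); split.
- exact/measurableC/measurable_eventually_good.
- exact: prob_eventually_good.
- apply: subsetC => w gw t; rewrite /X mem_set//.
  have HK := eventually_good_laminar gw; rewrite (marks_pathE _ HK).
  rewrite (lamination_at_marks (eventually_good_EG gw) (timeT_le t)).
  by [].
Unshelve. all: by end_near. Qed.

End good_events.

(** * Test functions along the process *)

Section processes.
Context {R : realType}.

Lemma skorokhod_eq (c : R) (x y : skorokhod (lamination R) c) :
  (forall t, x t = y t :> set R[i]) -> x = y.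
Proof.
move=> xy; have {xy} : skorokhod_fun x = skorokhod_fun y.
  apply/funext => t; have := xy t; case: (x t) => A pA; case: (y t) => B pB /= AB.
  by subst B; congr Lamination; exact: Prop_irrelevance.
case: x y => x cx [y cy] /= xy; subst y; congr Skorokhod; exact: Prop_irrelevance.
Qed.

Context d {Om : measurableType d}.
Variables (f : R -> R) (S c : R).
Hypotheses (hf : continuous_excursion_type f) (S0 : 0 <= S)
  (fS : forall s, 0 <= s <= 1 -> f s <= S) (c0 : 0 < c).
Variables (P : probability Om R) (N : Om -> set (R * R * R)).
Hypothesis hN : poisson_point_process P (intensity f) N.
Variable X : Om -> skorokhod (lamination R) c.
Hypothesis hX : lamination_process P f N X.

(** Any version of the process agrees, off a null set, with the path built from the marks, to which
    the discretization applies. *)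
Lemma process_ae : exists Z : set Om, [/\ measurable Z, P Z = 0%E &
  forall w, ~ Z w -> eventually_good f S c N w /\ X w = marks_path c (marks f c (N w))].
Proof.
have [_ [Z [mZ Z0 XZ]]] := hX.
have mE := measurable_eventually_good S hf c0 hN.
have E0 := prob_eventually_good hf S0 fS c0 hN.
exists (Z `|` ~` eventually_good f S c N); split.
- by apply: measurableU => //; exact: measurableC.
- by apply: null_set_setU => //; exact: measurableC.
- move=> w /not_orP[nZ /contrapT gw]; split => //.
  have HK := eventually_good_laminar hf c0 gw.
  have Xw : forall s : timeT c, X w s = lamination_at f (N w) (set_val s) :> set R[i].
    by apply: contrapT => h; apply: nZ; exact: XZ.
  rewrite (marks_pathE _ HK); apply: skorokhod_eq => t; rewrite Xw.
  by rewrite (lamination_at_marks (eventually_good_EG gw) (timeT_le t)).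
Qed.

Variables (phi : skorokhod (lamination R) c -> R) (M : R).
Hypotheses (cphi : continuous phi) (phiM : forall x, `|phi x| <= M).

(* The test function phi is not uniformly continuous: the rounded path is tested against this
   lower envelope, which bounds phi from below at the original path and tends to it as k grows. *)
Definition lower_env (k : nat) x : R := inf [set phi y | y in j1_ball x (mesh c k)].

Let M0 : 0 <= M. Proof. by rewrite (le_trans _ (phiM (lam_path c marked_laminar0))). Qed.

Lemma lower_env_le k x y : j1_ball x (mesh c k) y -> lower_env k x <= phi y.
Proof.
move=> xy; apply: ge_inf; last by exists y.
by exists (- M) => _ [z _ <-]; have := phiM z; rewrite ler_norml => /andP[].
Qed.

Lemma lower_env_ge k x r : (forall y, j1_ball x (mesh c k) y -> r <= phi y) ->
  r <= lower_env k x.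
Proof.
move=> h; apply: lb_le_inf; last by move=> _ [y xy <-]; exact: h.
by exists (phi x), x => //; exact: (@ballxx _ _ x _ (mesh_gt0 c0 k)).
Qed.

Lemma lower_env_bound k x : `|lower_env k x| <= M.
Proof.
rewrite ler_norml; apply/andP; split.
  by apply: lower_env_ge => y _; have := phiM y; rewrite ler_norml => /andP[].
apply: le_trans (lower_env_le (@ballxx _ _ x _ (mesh_gt0 c0 k))) _.
by have := phiM x; rewrite ler_norml => /andP[].
Qed.

Let psi k w : R := lower_env k (pattern_path c (pattern_at f S c N k w)).

Lemma phi_process_measurable : measurable_fun setT (phi \o X).
Proof.
move=> _; apply: (measurability _ (RGenOInfty.measurableE R)) => // _ [_ [x ->] <-].
rewrite setTI comp_preimage; have [mX _] := hX; apply: mX; apply: sub_sigma_algebra.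
by move: cphi => /continuousP; apply; exact: interval_open.
Qed.

Lemma psi_measurable k : measurable_fun setT (psi k).
Proof.
move=> _ B mB; rewrite setTI.
rewrite (_ : _ @^-1` _ = pattern_at f S c N k @^-1`
  [set b | B (lower_env k (pattern_path c b))])//.
by apply: measurable_finite_preimage => b; exact: (measurable_pattern_at hf c0 hN).
Qed.

Lemma bounded_integrable (g : Om -> R) (b : R) : measurable_fun setT g ->
  (forall w, `|g w| <= b) -> P.-integrable setT (EFin \o g).
Proof.
move=> mg gb; apply: (le_integrable measurableT _ _
  (finite_measure_integrable_cst P b measurableT)).
- exact/measurable_EFinP.
- by move=> w _ /=; rewrite lee_fin (le_trans (gb w))// ler_norm.
Qed.

Lemma expectation_fin (g : Om -> R) (b : R) : measurable_fun setT g ->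
  (forall w, `|g w| <= b) -> ('E_P[g])%E \is a fin_num.
Proof.
by move=> mg gb; rewrite unlock integrable_fin_num//; exact: (bounded_integrable mg gb).
Qed.

(** The envelope is at most [phi] of the process on the good event; elsewhere it exceeds it by at
    most 2 M. The error term depends on neither the excursion nor the configuration, so it serves
    for all f_n at once. *)
Lemma expectation_ge_env k :
  fine ('E_P[psi k])%E - 2 * M * (1 / (2 ^ k.+1)%:R) <= fine ('E_P[phi \o X])%E.
Proof.
have [Z [mZ Z0 XZ]] := process_ae.
have mg := measurable_good_at S hf c0 hN k.
set W := Z `|` ~` good_at f S c N k.
have mW : measurable W by apply: measurableU => //; exact: measurableC.
have PW : (P W <= (1 / (2 ^ k.+1)%:R)%:E)%E.
  have := measureU2 P mZ (measurableC mg); move/le_trans; apply.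
  rewrite [X in (X + _)%E](_ : _ = 0%E)// add0e.
  exact: (prob_not_good_at hf S0 fS c0 hN).
have psi_le w : psi k w <= phi (X w) + 2 * M * \1_W w.
  have [Ww|nW] := pselect (W w).
    rewrite indicE mem_set// mulr1.
    have := lower_env_bound k (pattern_path c (pattern_at f S c N k w)).
    have := phiM (X w); rewrite !ler_norml /psi; lra.
  rewrite indicE memNset// mulr0 addr0.
  move: nW => /not_orP[nZ /contrapT gw]; have [ew Xw] := XZ w nZ.
  apply: lower_env_le; apply: (@ball_sym _ (skorokhod (lamination R) c)).
  by rewrite Xw; exact: (good_at_j1 hf c0 gw (eventually_good_laminar hf c0 ew)).
have i1 := bounded_integrable (psi_measurable k) (fun w => lower_env_bound _ _).
have i2 := bounded_integrable phi_process_measurable (fun w => phiM (X w)).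
have i3 : P.-integrable setT (fun w => (2 * M)%:E * (\1_W w)%:E)%E.
  by apply: integrableZl => //; exact: integrable_indic.
have f1 := expectation_fin (psi_measurable k) (fun w => lower_env_bound _ _).
have f2 := expectation_fin phi_process_measurable (fun w => phiM (X w)).
rewrite -lee_fin EFinB !fineK// leeBlDr//.
have : ('E_P[psi k] <= 'E_P[phi \o X] + (2 * M)%:E * P W)%E.
  rewrite unlock (_ : ((2 * M)%:E * P W)%E = \int[P]_w ((2 * M)%:E * (\1_W w)%:E)%E)%E.
    rewrite -integralD//; apply: le_integral => //; first exact: integrableD.
    by move=> w _; rewrite /= -EFinM -EFinD lee_fin psi_le.
  by rewrite integralZl ?integral_indic ?setIT//; exact: integrable_indic.
move/le_trans; apply; rewrite leeD2l// [leRHS]EFinM lee_wpmul2l// lee_fin mulr_ge0//.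
Qed.

(** Dominated convergence: the envelope at the rounded path is an infimum of [phi] over points
    within two meshes of [X w], where [phi] is continuous. *)
Lemma expectation_env_cvg : ('E_P[psi k])%E @[k --> \oo] --> ('E_P[phi \o X])%E.
Proof.
rewrite unlock; have [Z [mZ Z0 XZ]] := process_ae.
have mpsi k : measurable_fun setT (EFin \o psi k).
  by apply/measurable_EFinP; exact: psi_measurable.
have mphi : measurable_fun setT (EFin \o (phi \o X)).
  by apply/measurable_EFinP; exact: phi_process_measurable.
have iM := finite_measure_integrable_cst P M measurableT.
have ae_dom : {ae P, forall w k, setT w -> (`|(EFin \o psi k) w| <= (EFin \o cst M) w)%E}.
  by apply: aeW => w k _ /=; rewrite lee_fin lower_env_bound.
have ae_cvg : {ae P, forall w, setT w -> (EFin \o psi k) w @[k --> \oo] --> (EFin \o (phi \o X)) w}.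
  exists Z; split => // w /= /not_implyP[_ nw]; apply: contrapT => nZ; apply: nw.
  apply: cvg_EFin; first by near=> k.
  have [ew Xw] := XZ w nZ; have HK := eventually_good_laminar hf c0 ew.
  have [j Hj] := eventually_goodP ew.
  apply/cvgrPdist_le => /= e e0.
  have /cvgrPdist_lt /(_ _ e0) /nbhs_ballP[r /= r0 Hr] := @cphi (X w).
  (* One half for the distance to the rounded path, the other for the radius of the envelope. *)
  have r20 : 0 < r / 2 by rewrite divr_gt0.
  near=> k; have gk : good_at f S c N k w by apply: Hj; near: k; exact: nbhs_infty_ge.
  have mk : mesh c k < r / 2 by near: k; exact: mesh_cvg0.
  have bk : ball (X w) (mesh c k) (pattern_path c (pattern_at f S c N k w)).
    by rewrite Xw; exact: (good_at_j1 hf c0 gk HK).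
  rewrite ler_distlC; apply/andP; split.
    apply: lower_env_ge => y yb; have : ball (X w) r y.
      rewrite (splitr r); apply: (ball_triangle (le_ball (ltW mk) bk)).
      by apply: (le_ball (ltW mk)); exact: yb.
    by move/Hr; rewrite ltr_distlC => /andP[/ltW].
  apply: (@le_trans _ _ (phi (X w))); last by rewrite lerDl ltW.
  by apply: lower_env_le; exact: (ball_sym bk).
by have [_ _] := @dominated_convergence _ _ R P setT measurableT
  (fun k => EFin \o psi k) (EFin \o (phi \o X)) (EFin \o cst M) mpsi mphi ae_cvg iM ae_dom.
Unshelve. all: by end_near. Qed.

End processes.

(** * Convergence in distribution *)

Section uniform_bounds.
Context {R : realType}.
Variables (f_ : nat -> R -> R) (f : R -> R).
Hypotheses (hf_ : forall n, continuous_excursion_type (f_ n))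
  (hf : continuous_excursion_type f).

Lemma uniform_cvg_near (A : set R) : {uniform A, f_ @ \oo --> f} -> forall e, 0 < e ->
  \forall n \near \oo, forall s, A s -> `|f s - f_ n s| < e.
Proof.
move=> f_f e e0.
apply: (f_f [set h | forall s, A s -> `|f s - h s| < e]).
apply/uniform_nbhs; exists [set xy : R * R | `|xy.1 - xy.2| < e]; split => //.
exact: (entourage_ball R (PosNum e0)).
Qed.

Lemma excursion_bounded : exists S, forall s, 0 <= s <= 1 -> f s <= S.
Proof.
have [cf _ _] := hf; have [s s01 smax] := EVT_max ler01 cf.
by exists (f s) => t t01; apply: smax; rewrite in_itv.
Qed.

End uniform_bounds.

(** From some rank on f_n is within 1 of f; the bounds of the finitely many earlier excursions are
    added. *)
Lemma excursions_bounded {R : realType} (f_ : nat -> R -> R) (f : R -> R) :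
  (forall n, continuous_excursion_type (f_ n)) -> continuous_excursion_type f ->
  (forall e, 0 < e -> \forall n \near \oo, forall s, 0 <= s <= 1 -> `|f s - f_ n s| < e) ->
  exists S, [/\ 0 <= S, forall s, 0 <= s <= 1 -> f s <= S &
    forall n s, 0 <= s <= 1 -> f_ n s <= S].
Proof.
move=> hf_ hf f_f; have [T fT] := excursion_bounded hf.
have [T_ f_T] := choice (fun n => excursion_bounded (hf_ n)).
have [n0 _ near0] := f_f 1 ltr01.
have sum0 : 0 <= \sum_(i < n0) `|T_ i| by apply: sumr_ge0.
exists (`|T| + 1 + \sum_(i < n0) `|T_ i|); split.
- by rewrite !addr_ge0.
- by move=> s /fT; have := ler_norm T; lra.
- move=> n s s01; have [n0n|nn0] := leqP n0 n.
    have := near0 n n0n s s01; have := fT s s01; have := ler_norm T.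
    by rewrite ltr_norml; lra.
  have : `|T_ n| <= \sum_(i < n0) `|T_ i|.
    by rewrite (bigD1 (Ordinal nn0))//= lerDl sumr_ge0.
  by have := f_T n s s01; have := ler_norm (T_ n); have := normr_ge0 T; lra.
Qed.

Section pattern_convergence.
Context {R : realType}.
Variables (f_ : nat -> R -> R) (f : R -> R) (S c : R).
Hypotheses (hf_ : forall n, continuous_excursion_type (f_ n))
  (hf : continuous_excursion_type f) (f0 : f 0 = 0).
Hypothesis f_f : forall e, 0 < e ->
  \forall n \near \oo, forall s, 0 <= s <= 1 -> `|f s - f_ n s| < e.
Hypotheses (S0 : 0 <= S) (fS : forall s, 0 <= s <= 1 -> f s <= S)
  (f_S : forall n s, 0 <= s <= 1 -> f_ n s <= S) (c0 : 0 < c).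
Variables (d_ : nat -> measure_display) (Om_ : forall n, measurableType (d_ n))
  (P_ : forall n, probability (Om_ n) R) (N_ : forall n, Om_ n -> set (R * R * R))
  (hN_ : forall n, poisson_point_process (P_ n) (intensity (f_ n)) (@N_ n))
  (d : measure_display) (Om : measurableType d) (P : probability Om R)
  (N : Om -> set (R * R * R)) (hN : poisson_point_process P (intensity f) N).

Let reg (g : R -> R) k := @index_region R c k.+1 (steps S c k) g.

Lemma trivIset_index_region (g : R -> R) k : trivIset setT (@reg g k).
Proof.
move=> [[i1 i2] i3] [[j1 j2] j3] _ _ [p []]; rewrite /reg /index_region.
case: ifP => // _ [_ _ pi]; case: ifP => // _ [_ _ pj].
have := pi; rewrite pj /index_cell /= => -[e1 e2 e3].
by congr (_, _, _); apply: val_inj.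
Qed.

Lemma measurable_index_region g k i : continuous_excursion_type g -> measurable (@reg g k i).
Proof.
move=> hg; rewrite /reg /index_region; case: ifP => // _.
by apply: measurable_region => //; exact: steps_gt0.
Qed.

Lemma intensity_set0 (g : R -> R) : intensity g set0 = 0%E.
Proof. by rewrite /intensity integral_set0. Qed.

Lemma intensity_index_region_fin g k i : continuous_excursion_type g ->
  (forall s, 0 <= s <= 1 -> g s <= S) -> intensity g (@reg g k i) \is a fin_num.
Proof.
move=> hg gS; rewrite /reg /index_region; case: ifP => [li|_].
  by apply: (@intensity_region_fin _ _ _ _ _ _ _ _ S) => //; exact: steps_gt0.
by rewrite intensity_set0.
Qed.

Lemma intensity_index_region_cvg k i :
  intensity (f_ n) (@reg (f_ n) k i) @[n --> \oo] --> intensity f (@reg f k i).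
Proof.
rewrite /reg /index_region; case: ifP => [li|_].
  exact: (intensity_region_cvg c0 (ltn0Sn k) (steps_gt0 _ _ _) hf_ hf f0 f_f S0 f_S li).
by rewrite intensity_set0; under eq_fun do rewrite intensity_set0; exact: cvg_cst.
Qed.

Lemma prob_pattern d' (Om' : measurableType d') (P' : probability Om' R)
    (N' : Om' -> set (R * R * R)) g k b : continuous_excursion_type g ->
  (forall s, 0 <= s <= 1 -> g s <= S) -> poisson_point_process P' (intensity g) N' ->
  P' (pattern_at g S c N' k @^-1` [set b]) =
  (\prod_i void_prob (b i) (intensity g (@reg g k i)))%:E.
Proof.
move=> hg gS hN'; rewrite -(ppp_pattern hN' b (A := @reg g k)).
- congr (P' _); apply/seteqP; split => w /=; first by move=> <- i; rewrite ffunE.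
  by move=> H; apply/ffunP => i; rewrite ffunE; exact: H.
- by move=> i; exact: measurable_index_region.
- exact: trivIset_index_region.
- by move=> i; rewrite ltey_eq intensity_index_region_fin.
Qed.

Lemma void_prob_cvg (b : bool) (y_ : nat -> \bar R) (y : \bar R) : y \is a fin_num ->
  y_ n @[n --> \oo] --> y -> void_prob b (y_ n) @[n --> \oo] --> void_prob b y.
Proof.
move=> yfin y_y.
have e_e : expR (- fine (y_ n)) @[n --> \oo] --> expR (- fine y).
  apply: continuous_cvg; first exact: continuous_expR.
  by apply: cvgN; apply: fine_cvg; rewrite fineK.
by rewrite /void_prob; case: b => //; apply: cvgB => //; exact: cvg_cst.
Qed.

(** There are finitely many patterns, and the probability of each is a product of continuous
    functions of the intensities. *)
Lemma expectation_pattern_cvg k (h : {ffun cell_index k.+1 (steps S c k) -> bool} -> R) :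
  ('E_(P_ n)[h \o pattern_at (f_ n) S c (@N_ n) k])%E @[n --> \oo] -->
  ('E_P[h \o pattern_at f S c N k])%E.
Proof.
have EE d' (Om' : measurableType d') (P' : probability Om' R)
    (N' : Om' -> set (R * R * R)) g : continuous_excursion_type g ->
  (forall s, 0 <= s <= 1 -> g s <= S) -> poisson_point_process P' (intensity g) N' ->
  ('E_P'[h \o pattern_at g S c N' k])%E =
  (\sum_b h b * \prod_i void_prob (b i) (intensity g (@reg g k i)))%:E.
  move=> hg gS hN'; rewrite expectation_finite; last first.
    by move=> b; exact: (measurable_pattern_at hg c0 hN').
  rewrite -sumEFin; apply: eq_bigr => b _.
  by rewrite (prob_pattern _ hg gS hN') EFinM.
rewrite (EE _ _ _ _ _ hf fS hN).
under eq_fun => n do rewrite (EE _ _ _ _ _ (hf_ n) (f_S n) (hN_ n)).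
apply: cvg_EFin; first by near=> n.
apply: cvg_big => [|b _]; first exact: add_continuous.
apply: cvgMr; apply: cvg_big => [|i _]; first exact: mul_continuous.
apply: void_prob_cvg.
  exact: intensity_index_region_fin.
exact: intensity_index_region_cvg.
Unshelve. all: by end_near. Qed.

Variables (X_ : forall n, Om_ n -> skorokhod (lamination R) c)
  (X : Om -> skorokhod (lamination R) c).
Hypotheses (hX_ : forall n, lamination_process (P_ n) (f_ n) (@N_ n) (@X_ n))
  (hX : lamination_process P f N X).

(** The scale k is chosen first, from f and M alone: one third of e for the envelope under f, one
    for the bad event, uniformly in n. The last third is for the law of the pattern at this fixed
    scale, as n grows. *)
Lemma expectation_near_ge (phi : skorokhod (lamination R) c -> R) (M e : R) :
  continuous phi -> (forall x, `|phi x| <= M) -> 0 < e ->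
  \forall n \near \oo, fine ('E_P[phi \o X])%E - e <= fine ('E_(P_ n)[phi \o @X_ n])%E.
Proof.
move=> cphi phiM e0.
have M0 : 0 <= M by rewrite (le_trans _ (phiM (lam_path c marked_laminar0))).
have fphi := expectation_fin P (phi_process_measurable hX cphi) (fun w => phiM (X w)).
have e3 : 0 < e / 3 by rewrite divr_gt0.
have env := expectation_env_cvg hf S0 fS c0 hN hX cphi phiM.
have env' : fine ('E_P[lower_env phi k \o (pattern_path c (n := steps S c k)) \o
    pattern_at f S c N k])%E @[k --> \oo] --> fine ('E_P[phi \o X])%E.
  by apply: fine_cvg; rewrite fineK.
have fenv : \forall k \near \oo, fine ('E_P[phi \o X])%E - e / 3 <=
    fine ('E_P[lower_env phi k \o (pattern_path c (n := steps S c k)) \o pattern_at f S c N k])%E.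
  move/cvgrPdist_le : env' => /(_ _ e3).
  by apply: filterS => k; rewrite ler_distlC => /andP[].
have small : \forall k \near \oo, 2 * M * (1 / (2 ^ k.+1)%:R) <= e / 3.
  (* The aim 2 M / 2^(k + 1) <= e / 3 reads 6 M / e <= 2^(k + 1), and k + 1 <= 2^(k + 1). *)
  exists (Num.truncn (6 * M / e)) => // k /= kM.
  have k0 : 0 < (2 ^ k.+1)%:R :> R by rewrite ltr0n expn_gt0.
  rewrite mulrA mulr1 ler_pdivrMr//.
  have : 6 * M / e <= (2 ^ k.+1)%:R.
    apply: le_trans (ltW (truncnS_gt _)) _; rewrite ler_nat.
    by rewrite (leq_trans (_ : _ <= k.+1)%N)// ltnW// ltn_expl.
  by rewrite ler_pdivrMr//; lra.
have [k [Hk1 Hk2]] : exists k, fine ('E_P[phi \o X])%E - e / 3 <=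
    fine ('E_P[lower_env phi k \o (pattern_path c (n := steps S c k)) \o pattern_at f S c N k])%E /\
    2 * M * (1 / (2 ^ k.+1)%:R) <= e / 3.
  have [k1 _ H1] := fenv; have [k2 _ H2] := small.
  by exists (maxn k1 k2); split; [apply: H1; exact: leq_maxl|apply: H2; exact: leq_maxr].
have patt := @expectation_pattern_cvg k (lower_env phi k \o (pattern_path c (n := steps S c k))).
set E0 := 'E_P[_]%E in patt Hk1.
have fE0 : E0 \is a fin_num.
  apply: (@expectation_fin _ _ _ P _ M) => [|w]; last exact: lower_env_bound.
  exact: (psi_measurable S hf c0 hN phi k).
have patt' : fine ('E_(P_ n)[(lower_env phi k \o (pattern_path c (n := steps S c k))) \o
    pattern_at (f_ n) S c (@N_ n) k])%E @[n --> \oo] --> fine E0.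
  by apply: fine_cvg; rewrite fineK.
have chain (a b x y t : R) : y - t <= b -> x - e / 3 <= y -> a - e / 3 <= x -> t <= e / 3 ->
  a - e <= b by lra.
move/cvgrPdist_le : patt' => /(_ _ e3).
apply: filterS => n; rewrite ler_distlC => /andP[Hn _].
have En := expectation_ge_env (hf_ n) S0 (f_S n) c0 (hN_ n) (hX_ n) cphi phiM k.
exact: (chain _ _ _ _ _ En Hn Hk1 Hk2).
Qed.

(** The lower estimate for [- phi] is the upper estimate for [phi]. *)
Lemma expectation_cvg (phi : skorokhod (lamination R) c -> R) (M : R) :
  continuous phi -> (forall x, `|phi x| <= M) ->
  ('E_(P_ n)[phi \o @X_ n])%E @[n --> \oo] --> ('E_P[phi \o X])%E.
Proof.
move=> cphi phiM.
have fin d' (Om' : measurableType d') (P' : probability Om' R) g N'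
    (Y : Om' -> skorokhod (lamination R) c) (hY : lamination_process P' g N' Y) :
    ('E_P'[phi \o Y])%E \is a fin_num.
  exact: (expectation_fin P' (phi_process_measurable hY cphi) (fun w => phiM (Y w))).
have neg d' (Om' : measurableType d') (P' : probability Om' R) g N'
    (Y : Om' -> skorokhod (lamination R) c) (hY : lamination_process P' g N' Y) :
    fine ('E_P'[(fun x => (- phi x)%R) \o Y])%E = - fine ('E_P'[phi \o Y])%E.
  have i := bounded_integrable P' (phi_process_measurable hY cphi) (fun w => phiM (Y w)).
  rewrite unlock -fineN -integralN ?integrable_add_def//=.
rewrite -(fineK (fin _ _ _ _ _ _ hX)).
under eq_fun => n do rewrite -(fineK (fin _ _ _ _ _ _ (hX_ n))).
apply: cvg_EFin; first by near=> n.
apply/cvgrPdist_le => e e0.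
have lower := expectation_near_ge cphi phiM e0.
have cNphi : continuous (fun x => - phi x) by move=> x; exact: (continuousN (@cphi x)).
have NphiM x : `|- phi x| <= M by rewrite normrN.
have upper := expectation_near_ge cNphi NphiM e0.
near=> n; rewrite ler_distlC; apply/andP; split; first by near: n.
have : fine ('E_P[(fun x => (- phi x)%R) \o X])%E - e <=
    fine ('E_(P_ n)[(fun x => (- phi x)%R) \o @X_ n])%E by near: n.
by rewrite (neg _ _ _ _ _ _ hX) (neg _ _ _ _ _ _ (hX_ n)) -opprD lerN2.
Unshelve. all: by end_near. Qed.

End pattern_convergence.

Theorem theorem2p4 (R : realType) (f_ : nat -> R -> R) (f : R -> R)
  (hf_ : forall n, continuous_excursion_type (f_ n))
  (hf_0 : forall n, f_ n 0 = 0)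
  (hf : continuous_excursion_type f)
  (hf0 : f 0 = 0)
  (hcvg : {uniform `[0, 1], f_ @ \oo --> f})
  (c : R) (hc : 0 < c)
  (d_ : nat -> measure_display) (Om_ : forall n, measurableType (d_ n))
  (P_ : forall n, probability (Om_ n) R)
  (N_ : forall n, Om_ n -> set (R * R * R))
  (hN_ : forall n, poisson_point_process (P_ n) (intensity (f_ n)) (N_ n))
  (d : measure_display) (Om : measurableType d) (P : probability Om R)
  (N : Om -> set (R * R * R))
  (hN : poisson_point_process P (intensity f) N) :
  [/\ forall n, exists X : Om_ n -> skorokhod (lamination R) c,
        lamination_process (P_ n) (f_ n) (N_ n) X,
      exists X : Om -> skorokhod (lamination R) c,
        lamination_process P f N X &
      forall (X_ : forall n, Om_ n -> skorokhod (lamination R) c)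
             (X : Om -> skorokhod (lamination R) c),
        (forall n, lamination_process (P_ n) (f_ n) (N_ n) (X_ n)) ->
        lamination_process P f N X ->
        cvg_in_distribution P_ X_ P X].
Proof.
have f_f e : 0 < e -> \forall n \near \oo, forall s, 0 <= s <= 1 -> `|f s - f_ n s| < e.
  move=> e0; have := uniform_cvg_near hcvg e0; apply: filterS => n H s s01.
  by apply: H; rewrite /= in_itv.
have [S [S0 fS f_S]] := excursions_bounded hf_ hf f_f.
split.
- by move=> n; exact: (lamination_process_exists (hf_ n) S0 (f_S n) hc (hN_ n)).
- exact: (lamination_process_exists hf S0 fS hc hN).
- move=> X_ X hX_ hX phi cphi [M phiM].
  exact: (expectation_cvg hf_ hf hf0 f_f S0 fS f_S hc hN_ hN hX_ hX cphi phiM).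
Qed.
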